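(* Let $t\in\mathbb{R}$ be fixed and let $\widehat f_h(t)=\frac1n\sum_{i=1}^n Z_{i,h}(t)$, where the $Z_{i,h}(t)$ are the privatized observations produced either by the Laplace mechanism or by the Gaussian process mechanism described in the context, with bandwidth $h>0$ and with kernel $K=K_{\mathrm{sinc}}$. Then, for any $s>1/2$, $$\sup_{f\in\mathcal S(s,L)}\mathbf E\big[(\widehat f_h(t)-f(t))^2\big]\le C\Big[h^{2s-1}+\frac1{nh}+\frac1{nh^2}\Big]$$ for some $C=C(\alpha,\beta,L,s,\|f\|_\infty,K_{\mathrm{sinc}})$. In particular, setting $h=h^\star$ with $h^\star\asymp n^{-1/(2s+1)}$, one obtains $$\sup_{f\in\mathcal S(s,L)}\mathbf E\big[(\widehat f_{h^\star}(t)-f(t))^2\big]\lesssim n^{-\frac{2s-1}{2s+1}},$$ where $\lesssim$ means inequality up to a multiplicative constant not depending on $n$.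
   Context: Data: $X_1,\dots,X_n$ are i.i.d. real random variables with unknown probability density $f$. Sobolev ellipsoid: for $s>1/2$, $L>0$, $$\mathcal S(s,L)=\Big\{f:\mathbb R\to[0,\infty):\ \int f(x)\,dx=1,\ \int|\mathcal F[f](\omega)|^2|\omega|^{2s}\,d\omega\le 2\pi L^2\Big\},$$ where $\mathcal F[f](\omega)=\int e^{\mathrm i\omega x}f(x)\,dx$ is the Fourier transform of $f$. Since $s>1/2$, each such $f$ agrees a.e. with a continuous function, and $f(t)$ denotes the value of this continuous version at $t$. $\|f\|_\infty$ denotes the supremum norm of $f$. Kernel: $K=K_{\mathrm{sinc}}$ with $K_{\mathrm{sinc}}(u)=\frac{\sin(\pi u)}{\pi u}$ (value $1$ at $u=0$), and $K_h(u)=\frac1hK(u/h)$; $\|K\|_\infty=\sup_u|K(u)|$. Laplace mechanism ($\alpha>0$, $\beta\in[0,1]$): $$Z_{i,h}(t)=K_h(X_i-t)+\frac{2\|K\|_\infty}{h(\alpha-\log(1-\beta))}\,\xi_{i,h},$$ with $\xi_{i,h}$, $i=1,\dots,n$, i.i.d. with density $\frac12e^{-|x|}$, independent of $X_1,\dots,X_n$ (if $\beta=1$ the noise coefficient is $0$). Gaussian process mechanism ($\alpha>0$, $\beta\in(0,1/2)$): $$Z_{i,h}(t)=K_h(X_i-t)+\frac{\Delta'\sqrt{2\log(1/(2\beta))+2\alpha}}{h\alpha}\,\Xi_{i,h}(t),$$ with $\Xi_{i,h}$, $i=1,\dots,n$, i.i.d. centred Gaussian processes on $\mathbb R$ with covariance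 kernel $(x,y)\mapsto K((x-y)/h)$, independent of $X_1,\dots,X_n$. Here $\Delta'$ is a fixed constant depending only on $K$ (not on $h$ or $n$) which is an upper bound, over $x,x'\in\mathbb R$, for $\|K((x-\cdot)/h)-K((x'-\cdot)/h)\|_{\mathcal H}$, where $\mathcal H$ is the reproducing kernel Hilbert space of the kernel $(x,y)\mapsto K((x-y)/h)$. *)

(* Defs.v *)
From HB Require Import structures.
From mathcomp Require Import all_boot all_order all_algebra.
From mathcomp Require Import complex.
From mathcomp Require Import all_classical all_reals all_analysis.

Set Implicit Arguments.
Unset Strict Implicit.
Unset Printing Implicit Defensive.

Import Order.TTheory GRing.Theory Num.Theory.
Import numFieldNormedType.Exports.

Local Open Scope classical_set_scope.
Local Open Scope ring_scope.

(** * Sobolev ellipsoid *)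

(* F[f](w) = \int e^{iwx} f(x) dx, integrated componentwise. *)
Definition fourier (R : realType) (f : R -> R) (w : R) : R[i] :=
  Complex (\int[@lebesgue_measure R]_x (cos (w * x) * f x))
          (\int[@lebesgue_measure R]_x (sin (w * x) * f x)).

Record sobolev_ellipsoid (R : realType) (s L : R) (f : R -> R) : Prop := {
  sobolev_measurable : measurable_fun setT f ;
  sobolev_ge0 : forall x, 0 <= f x ;
  sobolev_mass : (\int[@lebesgue_measure R]_x (f x)%:E = 1)%E ;
  sobolev_energy :
    (\int[@lebesgue_measure R]_w
       ((ComplexField.Normc.normc (fourier f w)) ^+ 2 * `|w| `^ (2 * s))%:E
     <= (2 * pi * L ^+ 2)%:E)%E
}.

(* The continuous version of f; if f has none, the choice is arbitrary. *)
Definition continuous_version (R : realType) (f : R -> R) : R -> R :=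
  get [set g : R -> R |
       continuous g /\ {ae @lebesgue_measure R, forall x, f x = g x}].

(** * Kernels *)

Definition sinc_kernel (R : realType) (u : R) : R :=
  if u == 0 then 1 else sin (pi * u) / (pi * u).

Definition scaled_kernel (R : realType) (K : R -> R) (h u : R) : R :=
  h^-1 * K (u / h).

Definition sup_norm (R : realType) (K : R -> R) : R :=
  sup (range (fun u => `|K u|)).

(* [is_rkhs k H ip]: the set of functions H with inner product ip (relevant on
   H only) is the reproducing kernel Hilbert space of the kernel k. *)
Record is_rkhs (R : realType) (k : R -> R -> R)
    (H : set (R -> R)) (ip : (R -> R) -> (R -> R) -> R) : Prop := {
  rkhs_zero : H (fun _ => 0) ;
  rkhs_linear : forall (a : R) g1 g2, H g1 -> H g2 ->
    H (fun x => a * g1 x + g2 x) ;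
  rkhs_ip_sym : forall g1 g2, H g1 -> H g2 -> ip g1 g2 = ip g2 g1 ;
  rkhs_ip_linear : forall (a : R) g1 g2 g3, H g1 -> H g2 -> H g3 ->
    ip (fun x => a * g1 x + g2 x) g3 = a * ip g1 g3 + ip g2 g3 ;
  rkhs_ip_ge0 : forall g, H g -> 0 <= ip g g ;
  rkhs_ip_eq0 : forall g, H g -> ip g g = 0 -> g = (fun _ => 0) ;
  rkhs_complete : forall u : nat -> R -> R, (forall m, H (u m)) ->
    (forall e : R, 0 < e -> exists N : nat, forall m m' : nat,
       (N <= m)%N -> (N <= m')%N ->
       ip (fun x => u m x - u m' x) (fun x => u m x - u m' x) < e) ->
    exists2 g, H g &
      (fun m => ip (fun x => u m x - g x) (fun x => u m x - g x)) @ \oo --> 0 ;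
  rkhs_kernel : forall x, H (k x) ;
  rkhs_reproducing : forall g x, H g -> g x = ip g (k x)
}.

(* The bandwidth h ranges over all positive reals, so Delta depends on K only. *)
Definition rkhs_sensitivity_bound (R : realType) (K : R -> R) (Delta : R) :
    Prop :=
  forall h : R, 0 < h ->
  forall (H : set (R -> R)) (ip : (R -> R) -> (R -> R) -> R),
    is_rkhs (fun x y => K ((x - y) / h)) H ip ->
  forall x x' : R,
    let g := fun y => K ((x - y) / h) - K ((x' - y) / h) in
    Num.sqrt (ip g g) <= Delta.

(** * Independence and distributions *)

(* The sigma-algebra generated by a family of real random variables. *)
Definition sigma_family (R : realType) d (T : measurableType d) (I : Type)
    (Y : I -> T -> R) : set_system T :=
  <<s \bigcup_i preimage_set_system setT (Y i) measurable >>.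

Definition mutually_independent (R : realType) d (T : measurableType d)
    (P : probability T R) (I : finType) (G : I -> set_system T) : Prop :=
  forall (J : {set I}) (A : I -> set T), (forall i, i \in J -> G i (A i)) ->
    (P (\bigcap_(i in [set` J]) A i) = \prod_(i in J) P (A i))%E.

Definition independent_systems (R : realType) d (T : measurableType d)
    (P : probability T R) (G G' : set_system T) : Prop :=
  forall A B, G A -> G' B -> (P (A `&` B) = P A * P B)%E.

Definition iid_with_density (R : realType) d (T : measurableType d)
    (P : probability T R) n (X : 'I_n -> {RV P >-> R}) (p : R -> R) : Prop :=
  (forall i B, measurable B ->
     distribution P (X i) B = (\int[@lebesgue_measure R]_(x in B) (p x)%:E)%E)
  /\ mutually_independent P (fun i => sigma_family (fun _ : unit => X i)).

Definition laplace_pdf (R : realType) (x : R) : R := expR (- `|x|) / 2.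

(* Degenerate laws are handled apart, because [normal_prob m 0] is not a Dirac
   mass. *)
Definition gaussian_variable (R : realType) d (T : measurableType d)
    (P : probability T R) (Y : T -> R) : Prop :=
  (exists m sigma : R, 0 < sigma /\
     forall B, measurable B -> P (Y @^-1` B) = normal_prob m sigma B)
  \/ (exists m : R, {ae P, forall w, Y w = m}).

Definition centred_gaussian_process (R : realType) d (T : measurableType d)
    (P : probability T R) (Xi : R -> {RV P >-> R}) (k : R -> R -> R) : Prop :=
  [/\ (forall (m : nat) (a u : 'I_m -> R),
         gaussian_variable P (fun w => \sum_(j < m) a j * Xi (u j) w)),
      (forall u, ('E_P[Xi u] = 0)%E) &
      (forall u v, covariance P (Xi u) (Xi v) = (k u v)%:E)].

(** * Privacy mechanisms *)

Inductive mechanism (R : realType) : Type :=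
| Laplace (alpha beta : R)
| GaussianProcess (alpha beta Delta : R).

Definition admissible (R : realType) (K : R -> R) (M : mechanism R) : Prop :=
  match M with
  | Laplace alpha beta => 0 < alpha /\ 0 <= beta <= 1
  | GaussianProcess alpha beta Delta =>
      [/\ 0 < alpha, 0 < beta < 1 / 2 & rkhs_sensitivity_bound K Delta]
  end.

(* The test on beta is needed because [ln 0 = 0] in the library. *)
Definition laplace_scale (R : realType) (K : R -> R) (alpha beta h : R) : R :=
  if beta == 1 then 0
  else 2 * sup_norm K / (h * (alpha - ln (1 - beta))).

Definition gaussian_scale (R : realType) (alpha beta Delta h : R) : R :=
  Delta * Num.sqrt (2 * ln (1 / (2 * beta)) + 2 * alpha) / (h * alpha).

(* [Z] is the family of privatized observations obtained with mechanism [M]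
   from an n-sample of density f on the probability space (T, P). *)
Definition privatized_sample (R : realType) (K : R -> R) (M : mechanism R)
    (f : R -> R) (n : nat) (h : R) d (T : measurableType d)
    (P : probability T R) (Z : 'I_n -> R -> T -> R) : Prop :=
  exists2 X : 'I_n -> {RV P >-> R}, iid_with_density X f &
  match M with
  | Laplace alpha beta =>
      exists xi : 'I_n -> {RV P >-> R},
      [/\ iid_with_density xi (@laplace_pdf R),
          independent_systems P (sigma_family (fun i => X i))
                                (sigma_family (fun i => xi i)) &
          forall i t w, Z i t w =
            scaled_kernel K h (X i w - t) + laplace_scale K alpha beta h * xi i w]
  | GaussianProcess alpha beta Delta =>
      exists Xi : 'I_n -> R -> {RV P >-> R},
      [/\ (forall i,
             centred_gaussian_process (Xi i) (fun x y => K ((x - y) / h))),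
          mutually_independent P (fun i => sigma_family (fun u => Xi i u)),
          independent_systems P (sigma_family (fun i => X i))
            (sigma_family (fun iu : 'I_n * R => Xi iu.1 iu.2)) &
          forall i t w, Z i t w =
            scaled_kernel K h (X i w - t)
            + gaussian_scale alpha beta Delta h * Xi i t w]
  end.

Definition estimator (R : realType) (n : nat) (T : Type)
    (Z : 'I_n -> R -> T -> R) (t : R) (w : T) : R :=
  n%:R^-1 * \sum_(i < n) Z i t w.

(* sup over f in S(s, L) of E[(\hat f_h(t) - f(t))^2]; the supremum also runs
   over all realizations of the model, on which the risk does not depend. *)
Definition sup_risk (R : realType) (K : R -> R) (M : mechanism R)
    (s L : R) (n : nat) (h t : R) : \bar R :=
  ereal_sup [set r : \bar R |
    exists f : R -> R, sobolev_ellipsoid s L f /\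
    exists (d : measure_display) (T : measurableType d) (P : probability T R)
           (Z : 'I_n -> R -> T -> R),
      privatized_sample K M f h P Z /\
      r = ('E_P[fun w => ((estimator Z t w - continuous_version f t) ^+ 2)%R])%E].

(* Main.v *)
(*
The bias is estimated on the Fourier side and the variance by brute force.

Put phi_t(w) = int cos(w (x - t)) f(x) dx.  Since the sinc kernel is the Fourier
transform of an indicator, int K_h(x - t) f(x) dx = 1/pi int_0^{pi/h} phi_t, while
f(t) = 1/pi int_0^oo phi_t by Fourier inversion; the bias is thus at most
1/pi int_{pi/h}^oo |F[f]|, which the Sobolev energy bounds by a multiple of
h^(s - 1/2).

Inversion is proved by Abel summation: inserting e^{-ew} in the inversion integral
gives the convolution of f with the Poisson kernel, whose integral over [a, b] is a
combination of arctangents.  Letting e -> 0 shows that f and its inversion integral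
have the same integral over every [a, b], hence agree almost everywhere by Lebesgue
differentiation.

For the variance, |K_h| <= 1/h and the noise has scale of order 1/h; both sums are
sums of n centred pairwise uncorrelated terms, so each contributes O(1/(n h^2)).
The three sources of error are separated by (p + q + r)^2 <= 3 (p^2 + q^2 + r^2).
*)
Require Import Defs.
From HB Require Import structures.
From mathcomp Require Import all_boot all_order all_algebra.
From mathcomp Require Import all_classical all_reals all_analysis.
From mathcomp Require Import measurable_realfun ring lra.

Set Implicit Arguments.
Unset Strict Implicit.
Unset Printing Implicit Defensive.

Import Order.TTheory GRing.Theory Num.Theory.
Import numFieldNormedType.Exports.

Local Open Scope classical_set_scope.
Local Open Scope ring_scope.

(** * Parametric integrals *)

(** The condition s > 1/2 acts through one fact: w^(-2s) is integrable at infinity, so finite energy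
    makes |F[f]| integrable there. This yields the decay of the bias, and also the majorant under
    which the inversion integral converges and is continuous in t. The obstacle is that f is merely
    integrable and its value at t is that of [continuous_version f], the outcome of a choice; this
    choice must be identified with the inversion integral before the bias can be estimated. The rate
    comes from balancing h^(2s-1) against 1/(n h^2), which forces h of order n^(-1/(2s+1)). *)

Section parametric.
Context d (T : measurableType d) (R : realType) (mu : {measure set T -> \bar R}).

Lemma integrable_bounded_mul (k f : T -> R) (D : set T) : measurable D ->
  measurable_fun D k -> (forall x, `|k x| <= 1) ->
  mu.-integrable D (EFin \o f) ->
  mu.-integrable D (EFin \o (fun x => k x * f x)).
Proof.
move=> mD mk k1 If.
have /measurable_EFinP mf := measurable_int _ If.
apply: (le_integrable mD _ _ If).
  by apply/measurable_EFinP; exact: measurable_funM.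
move=> x _ /=; rewrite lee_fin normrM ler_piMl//.
Qed.

Lemma continuous_parametric_Rintegral (k : R -> T -> R) (f : T -> R) (D : set T) :
  measurable D ->
  (forall l, measurable_fun D (k l)) -> (forall l x, `|k l x| <= 1) ->
  (forall x, continuous (k ^~ x)) -> mu.-integrable D (EFin \o f) ->
  continuous (fun l => \int[mu]_(x in D) (k l x * f x)).
Proof.
move=> mD mk k1 ck If a.
have := @continuity_under_integral R d T mu (fun l x => k l x * f x) D
  mD (a - 1) (a + 1) _ _ (fun x => `|f x|) _ _ a.
apply.
- by move=> l _; exact: integrable_bounded_mul.
- by apply: aeW => x _ l _; apply: continuousM; [exact: ck|exact: cst_continuous].
- exact: (integrable_norm If).
- by move=> l _; apply: aeW => x _; rewrite normrM ler_piMl.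
- by rewrite inE/= in_itv/= ltrBlDr ltrDl andbb ltr01.
Qed.
End parametric.

Section fubini_R.
Context {R : realType}.
Notation mu := (@lebesgue_measure R).

(** Since |k| <= 1, the integrand is dominated by the product |m(w)| |f(x)|, which is integrable on
    the plane. The weight [m] is what varies between uses: constant on a bounded interval, or an
    exponential on the half line. *)
Lemma Rintegral_kernel_swap (D : set R) (k : R * R -> R) (m f : R -> R) :
  measurable D -> measurable_fun setT k -> (forall z, `|k z| <= 1) ->
  mu.-integrable D (EFin \o m) -> mu.-integrable setT (EFin \o f) ->
  \int[mu]_(w in D) (m w * \int[mu]_x (k (w, x) * f x)) =
  \int[mu]_x ((\int[mu]_(w in D) (k (w, x) * m w)) * f x).
Proof.
move=> mD mk k1 Im If.
have mf : measurable_fun setT f.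
  by apply/measurable_EFinP; exact: measurable_int If.
(* Extending [m] by 0 outside [D] turns the claim into Fubini on the whole plane. *)
pose m' := m \_ D.
have Im' : mu.-integrable setT (EFin \o m').
  by rewrite /m' -restrict_EFin; exact: (proj1 (@integrable_mkcond _ _ _ mu D _ mD)).
have mm' : measurable_fun setT m'.
  by apply/measurable_EFinP; exact: measurable_int Im'.
have mk1 w : measurable_fun setT (fun x => k (w, x)).
  by apply: measurableT_comp => //.
have mk2 x : measurable_fun setT (fun w => k (w, x)).
  by apply: measurableT_comp => //.
have Ikf w := @integrable_bounded_mul _ _ _ mu (fun x => k (w, x)) f setT
  measurableT (mk1 w) (fun x => k1 (w, x)) If.
have Ikm x := @integrable_bounded_mul _ _ _ mu (fun w => k (w, x)) m' setT
  measurableT (mk2 x) (fun w => k1 (w, x)) Im'.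
pose F z := (m' z.1 * (k z * f z.2))%:E.
have mF : measurable_fun [set: R * R] F.
  apply/measurable_EFinP; apply: measurable_funM.
    exact: (measurableT_comp mm' measurable_fst).
  apply: measurable_funM => //.
  exact: (measurableT_comp mf measurable_snd).
have IF : ((mu \x mu)%E).-integrable setT F.
  apply/(integrable12ltyP mu mu mF).
  apply: (@le_lt_trans _ _ (\int[mu]_x (`|m' x|%:E * \int[mu]_y `|(f y)%:E|))%E).
    apply: ge0_le_integral => //.
    - by move=> w _; exact: integral_ge0.
    - apply: (@measurable_fun_fubini_tonelli_F _ _ _ _ _ mu (abse \o F)) => //=.
      exact: measurableT_comp.
    - apply: emeasurable_funM => //; apply/measurable_EFinP.
      exact: measurableT_comp.
    - move=> w _; rewrite -ge0_integralZl//=; last exact/measurable_EFinP/measurableT_comp.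
      apply: ge0_le_integral => //.
      + apply/measurable_EFinP; apply: measurableT_comp => //.
        apply: measurable_funM => //; exact: (measurable_funM (mk1 w) mf).
      + by apply: emeasurable_funM => //; apply/measurable_EFinP; exact: measurableT_comp.
      + move=> x _; rewrite -EFinM lee_fin !normrM ler_wpM2l//.
        by rewrite ler_piMl.
  have [_ If1] := integrableP _ _ _ If.
  have [_ Im1] := integrableP _ _ _ Im'.
  rewrite ge0_integralZr//.
  - apply: lte_mul_pinfty => //; first exact: integral_ge0.
    by rewrite ge0_fin_numE//; exact: integral_ge0.
  - by apply/measurable_EFinP; exact: measurableT_comp.
  - exact: integral_ge0.
rewrite [LHS]Rintegral_mkcond /Rintegral; congr fine.
have := integral12_prod_meas1 IF.
rewrite -(integral21_prod_meas1 IF) => H.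
transitivity (\int[mu]_w \int[mu]_x F (w, x))%E.
  apply: eq_integral => w _; rewrite /F/=.
  rewrite (_ : ((fun w => _) \_ D) w = m' w * \int[mu]_x (k (w, x) * f x)); last first.
    by rewrite /m' !patchE; case: ifP => //; rewrite mul0r.
  rewrite -(RintegralZl (m' w) measurableT (Ikf w)).
  rewrite /Rintegral fineK//.
  apply: (@integrable_fin_num _ _ _ mu setT) => //.
  exact: (integrableZl measurableT (m' w) (Ikf w)).
rewrite [LHS]H; apply: eq_integral => x _; rewrite /F/=.
rewrite -/(Rintegral mu D _) Rintegral_mkcond.
rewrite (_ : \int[mu]_w ((fun w0 => k (w0, x) * m w0) \_ D) w =
             \int[mu]_w (k (w, x) * m' w)); last first.
  by apply: eq_Rintegral => w _; rewrite /m' !patchE; case: ifP => //; rewrite mulr0.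
rewrite -(RintegralZr (f x) measurableT (Ikm x)) /Rintegral fineK; last first.
  apply: (@integrable_fin_num _ _ _ mu setT) => //.
  exact: (integrableZr measurableT (f x) (Ikm x)).
by apply: eq_integral => w _; congr EFin; ring.
Qed.
End fubini_R.

Lemma Rintegral_dominated_convergence d (T : measurableType d) (R : realType)
    (mu : {measure set T -> \bar R}) (D : set T) (u : nat -> T -> R)
    (v g : T -> R) : measurable D ->
  (forall n, measurable_fun D (u n)) -> measurable_fun D v ->
  (forall x, D x -> u n x @[n --> \oo] --> v x) ->
  mu.-integrable D (EFin \o g) ->
  (forall n x, D x -> `|u n x| <= g x) ->
  \int[mu]_(x in D) u n x @[n --> \oo] --> \int[mu]_(x in D) v x.
Proof.
move=> mD mu_ mv uv Ig ug.
have [Iv _ H] : [/\ mu.-integrable D (EFin \o v),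
    (fun n => \int[mu]_(x in D) `|(u n x)%:E - (v x)%:E|)%E @ \oo --> 0%E &
    (fun n => \int[mu]_(x in D) (u n x)%:E)%E @ \oo -->
      (\int[mu]_(x in D) (v x)%:E)%E].
  apply: (@dominated_convergence _ _ _ mu D mD (fun n => EFin \o u n) _ (EFin \o g)) => //.
  - by move=> n; exact/measurable_EFinP.
  - exact/measurable_EFinP.
  - by apply: aeW => x Dx; apply: cvg_EFin; [exact: nearW|exact: uv].
  - by apply: aeW => x n Dx; rewrite lee_fin; exact: ug.
apply: fine_cvg; rewrite fineK//; exact: integrable_fin_num Iv.
Qed.

(** * Explicit integrals *)

Section ftc_is_derive.
Context {R : realType}.
Notation mu := (@lebesgue_measure R).

Lemma is_derive_continuous (F : R -> R) (x d : R) :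
  is_derive x 1 F d -> {for x, continuous F}.
Proof.
move=> dF; apply/differentiable_continuous/derivable1_diffP.
exact: ex_derive.
Qed.

Lemma is_derive_integral (F f : R -> R) (a b : R) : a < b ->
  (forall x : R, is_derive x 1 F (f x)) -> continuous f ->
  (\int[mu]_(x in `[a, b]) (f x)%:E = (F b - F a)%:E)%E.
Proof.
move=> ab dF cf; rewrite (@continuous_FTC2 _ f F)//.
- exact: continuous_subspaceT.
- split.
  + by move=> x _; exact: ex_derive.
  + by apply: cvg_at_right_filter; exact: is_derive_continuous.
  + by apply: cvg_at_left_filter; exact: is_derive_continuous.
- by move=> x _; rewrite derive1E; exact: derive_val.
Qed.

Lemma is_derive_integraly (F f : R -> R) (a l : R) :
  (forall x, a <= x -> 0 <= f x) ->
  (forall x : R, a <= x -> is_derive x 1 F (f x)) ->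
  (forall x, a <= x -> {for x, continuous f}) ->
  F x @[x --> +oo] --> l ->
  (\int[mu]_(x in `[a, +oo[) (f x)%:E = (l - F a)%:E)%E.
Proof.
move=> f0 dF cf Fl; rewrite (@ge0_continuous_FTC2y _ f F a l)//.
- apply/continuous_within_itvcyP; split.
    by move=> x; rewrite in_itv/= andbT => /ltW; exact: cf.
  by apply: cvg_at_right_filter; exact: cf.
- by move=> x /ltW ax; have := dF _ ax => dFx; exact: ex_derive.
- apply: cvg_at_right_filter; have := dF _ (lexx a); exact: is_derive_continuous.
- move=> x; rewrite in_itv/= andbT => /ltW ax; rewrite derive1E.
  by have := dF _ ax => dFx; exact: derive_val.
Qed.

Lemma integrable_ge0_itvy (f : R -> R) (a l : R) :
  measurable_fun `[a, +oo[ f -> (forall x, a <= x -> 0 <= f x) ->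
  (\int[mu]_(x in `[a, +oo[) (f x)%:E = l%:E)%E ->
  mu.-integrable `[a, +oo[ (EFin \o f).
Proof.
move=> mf f0 fl; apply/integrableP; split; first exact/measurable_EFinP.
under eq_integral.
  move=> x; rewrite inE/= in_itv/= andbT => ax.
  by rewrite ger0_norm ?f0//; over.
by rewrite fl ltry.
Qed.
End ftc_is_derive.

Section kernels.
Context {R : realType}.
Notation mu := (@lebesgue_measure R).

Lemma integral_cos_box (A u : R) : 0 < A ->
  \int[mu]_(w in `[0, A]) cos (w * u) = if u == 0 then A else sin (A * u) / u.
Proof.
move=> A0; case: ifPn => [/eqP ->|u0].
  under eq_Rintegral do rewrite mulr0 cos0.
  rewrite Rintegral_cst//= lebesgue_measure_itv/= lte_fin A0.
  by rewrite mul1r sube0.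
(* The primitive is written with function combinators so that instance resolution finds its
   derivative; [is_derive_eq] then leaves an algebraic identity. The later primitives follow the
   same pattern. *)
have dF (x : R) : is_derive x 1 ((sin \o (id * cst u)) * cst u^-1) (cos (x * u)).
  apply: is_derive_eq; rewrite !fctE/= /GRing.scale/= !(mulr0, add0r, mulr1).
  by rewrite mulrC -mulrA divff ?mulr1.
rewrite /Rintegral (is_derive_integral A0 dF)/=.
- by rewrite !fctE/= mul0r sin0 mul0r subr0.
- move=> x; apply: continuous_comp; last exact: continuous_cos.
  by apply: mulrr_continuous.
Qed.

Lemma integral_cos_sinc (h u : R) : 0 < h ->
  \int[mu]_(w in `[0, pi / h]) cos (w * u) =
  pi * scaled_kernel (@sinc_kernel R) h u.
Proof.
move=> h0; rewrite integral_cos_box ?divr_gt0 ?pi_gt0//.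
rewrite /scaled_kernel /sinc_kernel mulf_eq0 invr_eq0 (gt_eqF h0) orbF.
case: ifPn => [_|u0]; first by rewrite mulr1.
rewrite (_ : pi * (u / h) = pi / h * u); last by ring.
have := pi_gt0 R => /lt0r_neq0 p0; have h1 := lt0r_neq0 h0.
by move: pi p0 => q q0; field; rewrite u0 q0 h1.
Qed.

(** As a mean of cosines the kernel shows no singularity at 0: continuity and the bound by 1 both
    follow from this formula. The factor 1 plays the part of [f] in the parametric integral
    lemmas. *)
Lemma sinc_kernelE (u : R) :
  sinc_kernel u = pi^-1 * \int[mu]_(w in `[0, pi]) (cos (w * u) * 1).
Proof.
under [in RHS]eq_Rintegral do rewrite mulr1.
have := integral_cos_sinc u ltr01; rewrite /scaled_kernel !divr1 invr1 mul1r => ->.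
by rewrite mulrA mulVf ?mul1r// gt_eqF ?pi_gt0.
Qed.

Let integrable_one : mu.-integrable `[0, pi] (EFin \o cst (1 : R)).
Proof.
apply/integrableP; split; first exact/measurable_EFinP.
under eq_integral do rewrite /= normr1.
rewrite integral_cst//= lebesgue_measure_itv/=.
by case: ifP => _; rewrite mul1e ltry.
Qed.

Let continuous_cos_mull (x : R) : continuous (fun w : R => cos (w * x)).
Proof.
move=> w; apply: continuous_comp; last exact: continuous_cos.
exact: mulrr_continuous.
Qed.

Let continuous_cos_mulr (x : R) : continuous (fun w : R => cos (x * w)).
Proof.
move=> w; apply: continuous_comp; last exact: continuous_cos.
exact: mulrl_continuous.
Qed.

Lemma continuous_sinc_kernel : continuous (@sinc_kernel R).
Proof.
have -> : @sinc_kernel R =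
    (fun u => pi^-1 * \int[mu]_(w in `[0, pi]) (cos (w * u) * 1)).
  by apply/funext => u; exact: sinc_kernelE.
move=> u; apply: cvgM; first exact: cvg_cst.
apply: (@continuous_parametric_Rintegral _ _ R mu (fun u w => cos (w * u)) (cst 1) `[0, pi]) => //.
- by move=> l; apply: measurable_funTS; apply: continuous_measurable_fun.
- by move=> l x; exact: cos_max.
Qed.

Lemma sinc_kernel_le1 (u : R) : `|sinc_kernel u| <= 1.
Proof.
have pi0 := pi_gt0 R.
rewrite sinc_kernelE normrM ger0_norm ?invr_ge0 ?(ltW pi0)// mulrC ler_pdivrMr// mul1r.
have Ic : mu.-integrable `[0, pi] (EFin \o (fun w => cos (w * u) * 1)).
  apply: (integrable_bounded_mul _ _ _ integrable_one) => //.
  - by apply: measurable_funTS; apply: continuous_measurable_fun.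
  - by move=> x; exact: cos_max.
apply: (le_trans (le_normr_Rintegral _ Ic)) => //.
rewrite [leRHS](_ : pi = \int[mu]_(w in `[0, pi]) (1 : R)); last first.
  by rewrite Rintegral_cst//= lebesgue_measure_itv/= lte_fin pi0 mul1r sube0.
apply: le_Rintegral => //; first exact: (integrable_norm Ic).
by move=> x _; rewrite mulr1; exact: cos_max.
Qed.

Lemma scaled_sinc_le (h u : R) : 0 < h ->
  `|scaled_kernel (@sinc_kernel R) h u| <= h^-1.
Proof.
move=> h0; rewrite normrM ger0_norm ?invr_ge0 ?(ltW h0)//.
by rewrite ler_piMr ?invr_ge0 ?(ltW h0)// sinc_kernel_le1.
Qed.

Lemma continuous_scaled_sinc (h t : R) :
  continuous (fun x => scaled_kernel (@sinc_kernel R) h (x - t)).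
Proof.
move=> x; apply: cvgM; first exact: cvg_cst.
apply: (@continuous_comp _ _ _ (fun x => (x - t) / h) (@sinc_kernel R));
  last exact: continuous_sinc_kernel.
apply: cvgM; last exact: cvg_cst.
by apply: cvgB; [exact: cvg_id|exact: cvg_cst].
Qed.

Lemma cvgy_expRN (e : R) : 0 < e -> expR (- (e * x)) @[x --> +oo] --> (0 : R).
Proof.
move=> e0.
apply: (@cvg_comp _ _ _ ( *%R e) (fun z => expR (- z)) _ (pinfty_nbhs R)); last exact: cvgr_expR.
exact: gt0_cvgMry.
Qed.

Lemma is_derive_expRN (e x : R) :
  is_derive x 1 (fun x => expR (- (e * x))) (- e * expR (- (e * x))).
Proof.
apply: (@is_derive_eq _ _ _ (expR \o (- (cst e * id))) x 1).
by rewrite !fctE/= /GRing.scale/= !(mulr0, addr0, mulr1) mulrC.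
Qed.

Lemma continuous_expRN (e : R) : continuous (fun x : R => expR (- (e * x))).
Proof. by move=> x; exact: is_derive_continuous (is_derive_expRN e x). Qed.

Lemma integral_expRN (e : R) : 0 < e ->
  (\int[mu]_(w in `[0%R, +oo[) (expR (- (e * w)))%:E = (e^-1)%:E)%E.
Proof.
move=> e0.
have dF (x : R) : 0 <= x ->
    is_derive x 1 (- (cst e^-1 * (fun x => expR (- (e * x))))) (expR (- (e * x))).
  move=> _; have := is_derive_expRN e x => ?; apply: is_derive_eq.
  rewrite !fctE/= /GRing.scale/= !(mulr0, addr0) mulrA mulrN mulVf ?lt0r_neq0//.
  by rewrite mulN1r opprK.
rewrite (is_derive_integraly (l := 0) _ dF).
- by rewrite !fctE/= mulr0 oppr0 expR0 mulr1 sub0r opprK.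
- by move=> x _; exact: expR_ge0.
- by move=> x _; exact: continuous_expRN.
- rewrite [X in _ --> X](_ : 0 = - (e^-1 * 0)); last by rewrite mulr0 oppr0.
  by apply: cvgN; apply: cvgM; [exact: cvg_cst|exact: cvgy_expRN].
Qed.

Lemma integrable_expRN (e : R) : 0 < e ->
  mu.-integrable `[0%R, +oo[ (EFin \o (fun w => expR (- (e * w)))).
Proof.
move=> e0; apply: (integrable_ge0_itvy _ _ (integral_expRN e0)).
- by apply: measurable_funTS; apply: continuous_measurable_fun; exact: continuous_expRN.
- by move=> x _; exact: expR_ge0.
Qed.

(** The value is the real part of 1 / (e - iu), the integral of exp(-(e - iu) w) over w >= 0. *)
Lemma integral_cos_expRN (e u : R) : 0 < e ->
  \int[mu]_(w in `[0%R, +oo[) (cos (w * u) * expR (- (e * w))) =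
  e / (e ^+ 2 + u ^+ 2).
Proof.
move=> e0.
have D0 : e ^+ 2 + u ^+ 2 != 0.
  by rewrite gt_eqF// ltr_pwDl ?sqr_ge0// exprn_gt0.
(* Adding [1] to the cosine makes the integrand nonnegative, as the improper
   fundamental theorem of calculus requires. *)
pose f w : R := (1 + cos (w * u)) * expR (- (e * w)).
have cc : continuous (fun w : R => cos (w * u)).
  move=> x; apply: continuous_comp; last exact: continuous_cos.
  exact: mulrr_continuous.
have If : (\int[mu]_(w in `[0%R, +oo[) (f w)%:E
    = (e^-1 + e / (e ^+ 2 + u ^+ 2))%:E)%E.
  pose E x : R := expR (- (e * x)).
  have dF (x : R) : 0 <= x -> is_derive x 1
      (E * (cst (- e^-1) + (cst (u / (e ^+ 2 + u ^+ 2)) * (sin \o (id * cst u))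
            - cst (e / (e ^+ 2 + u ^+ 2)) * (cos \o (id * cst u))))) (f x).
    move=> _; have : is_derive x 1 E _ := is_derive_expRN e x.
    move=> ?; apply: is_derive_eq.
    rewrite !fctE/= /GRing.scale/= !(mulr0, addr0, mulr1, add0r) /f -/(E x).
    by field; rewrite ?D0 ?gt_eqF.
  rewrite (is_derive_integraly (l := 0) _ dF).
  - rewrite !fctE/= /E !(mulr0, mul0r) oppr0 expR0 sin0 cos0.
    by congr EFin; ring.
  - by move=> x _; rewrite mulr_ge0 ?expR_ge0// -lerBlDl sub0r cos_geN1.
  - move=> x _; apply: continuousM; last exact: continuous_expRN.
    by apply: continuousD; [exact: cst_continuous|exact: cc].
  (* The primitive is [E] times a bounded trigonometric factor, hence vanishes at infinity along
     with [E]. *)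
  - set G := cst (- e^-1) + _.
    pose M := e^-1 + `|u / (e ^+ 2 + u ^+ 2)| + `|e / (e ^+ 2 + u ^+ 2)|.
    have GM x : `|G x| <= M.
      rewrite /G !fctE/=; apply: (le_trans (ler_normD _ _)).
      rewrite normrN ger0_norm ?invr_ge0 ?(ltW e0)// /M -addrA lerD2l.
      apply: (le_trans (ler_normB _ _)); rewrite !normrM.
      by rewrite lerD// ler_piMr ?sin_max ?cos_max.
    apply: norm_cvg0; apply: (@squeeze_cvgr _ _ _ _ (fun=> 0) (fun x => E x * M)).
    + near=> x; rewrite normr_ge0/= fctE normrM ger0_norm ?expR_ge0//.
      by rewrite ler_wpM2l ?expR_ge0.
    + exact: cvg_cst.
    + rewrite -[X in _ --> X](mul0r M).
      by apply: cvgM; [exact: cvgy_expRN|exact: cvg_cst].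
have Ic : mu.-integrable `[0%R, +oo[ (EFin \o (fun w => cos (w * u) * expR (- (e * w)))).
  apply: integrable_bounded_mul; [by []| | |exact: integrable_expRN].
  - apply: measurable_funTS; exact: continuous_measurable_fun.
  - by move=> x; exact: cos_max.
have := If; rewrite /f.
under eq_integral do rewrite mulrDl mul1r EFinD.
rewrite integralD//=; last exact: integrable_expRN.
rewrite integral_expRN// EFinD => /eqP.
rewrite -(@fineK _ (\int[mu]_(x in `[0%R, +oo[) (cos (x * u) * expR (- (e * x)))%:E)%E); last first.
  exact: integrable_fin_num Ic.
by rewrite -!EFinD => /eqP[] /addrI.
Unshelve. all: by end_near. Qed.

Lemma integral_poisson (e x a b : R) : 0 < e -> a < b ->
  (\int[mu]_(t in `[a, b]) (e / (e ^+ 2 + (x - t) ^+ 2))%:E =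
   (atan ((b - x) / e) - atan ((a - x) / e))%:E)%E.
Proof.
move=> e0 ab.
have D0 t : e ^+ 2 + (x - t) ^+ 2 != 0.
  by rewrite gt_eqF// ltr_pwDl ?sqr_ge0// exprn_gt0.
have dF (t : R) : is_derive t 1 (atan \o ((id - cst x) * cst e^-1))
    (e / (e ^+ 2 + (x - t) ^+ 2)).
  apply: is_derive_eq.
  rewrite !fctE/= /GRing.scale/= !(mulr0, subr0, mulr1, add0r).
  have D1 : 1 + ((t - x) / e) ^+ 2 != 0.
    by rewrite gt_eqF// ltr_pwDl ?sqr_ge0.
  have e1 : e != 0 by rewrite gt_eqF.
  have E1 : e ^+ 2 + (x - t) ^+ 2 = e ^+ 2 * (1 + ((t - x) / e) ^+ 2).
    by field.
  rewrite E1; move: (1 + _) D1 => q q0; by field; rewrite e1 q0.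
rewrite (is_derive_integral ab dF).
  by congr EFin; rewrite !fctE/=.
move=> t; apply: cvgM; first exact: cvg_cst.
apply: cvgV; first exact: D0.
apply: cvgD; first exact: cvg_cst.
rewrite /GRing.exp/=; apply: cvgM; (apply: cvgB; [exact: cvg_cst|exact: cvg_id]).
Qed.

Lemma integral_powR_tail (A p : R) : 0 < A -> 1 < p ->
  (\int[mu]_(w in `[A, +oo[) (w `^ (- p))%:E = (A `^ (1 - p) / (p - 1))%:E)%E.
Proof.
move=> A0 p1; have p10 : p - 1 != 0 by rewrite subr_eq0 gt_eqF.
have dF (x : R) : A <= x ->
    is_derive x 1 (- (cst (p - 1)^-1 * (fun y : R => y `^ (1 - p)))) (x `^ (- p)).
  move=> Ax; have x0 := lt_le_trans A0 Ax.
  have := @is_derive1_powR R (1 - p) x x0 => ?; apply: is_derive_eq.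
  rewrite !fctE/= /GRing.scale/= !(mulr0, addr0).
  rewrite (_ : 1 - p - 1 = - p); last by ring.
  by rewrite mulrA -mulNr -mulrN opprB mulVf ?mul1r.
rewrite (is_derive_integraly (l := 0) _ dF).
- by rewrite !fctE/=; congr EFin; rewrite sub0r opprK mulrC.
- by move=> x _; exact: powR_ge0.
- move=> x Ax; have x0 := lt_le_trans A0 Ax.
  exact: is_derive_continuous (@is_derive1_powR R (- p) x x0).
- rewrite [X in _ --> X](_ : 0 = - ((p - 1)^-1 * 0)); last by rewrite mulr0 oppr0.
  apply: cvgN; apply: cvgM; first exact: cvg_cst.
  apply/cvgrPdist_le => d d0; near=> x.
  have x0 : 0 < x by near: x; exact: nbhs_pinfty_gt.
  rewrite sub0r normrN ger0_norm ?powR_ge0// -opprB powRN.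
  rewrite -[leRHS]invrK lef_pV2 ?posrE ?powR_gt0 ?invr_gt0//.
  (* The threshold is the point where x^(1-p) equals d. *)
  have -> : d^-1 = (d^-1 `^ (p - 1)^-1) `^ (p - 1).
    by rewrite -powRrM mulVf// powRr1// invr_ge0 ltW.
  have cx : d^-1 `^ (p - 1)^-1 <= x by near: x; exact: nbhs_pinfty_ge.
  by apply: ge0_ler_powR; rewrite ?nnegrE ?powR_ge0 ?subr_ge0 ?(ltW p1) ?(ltW x0).
Unshelve. all: by end_near. Qed.
End kernels.

(** * Bias of the sinc kernel *)

Section cos_transform.
Context {R : realType}.
Notation mu := (@lebesgue_measure R).

(* The real part of [e^{-iwt} F[f](w)]: it is even in [w], so Fourier inversion
   becomes an integral over the half line. *)
Definition cos_transform (f : R -> R) (t w : R) : R :=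
  \int[mu]_x (cos (w * (x - t)) * f x).

Definition fourier_modulus (f : R -> R) (w : R) : R :=
  complex.ComplexField.Normc.normc (fourier f w).

Let continuous_cosl (x t : R) : continuous (fun w : R => cos (w * (x - t))).
Proof.
move=> w; apply: continuous_comp; last exact: continuous_cos.
exact: mulrr_continuous.
Qed.

Let continuous_cosr (w x : R) : continuous (fun t : R => cos (w * (x - t))).
Proof.
move=> t; apply: continuous_comp; last exact: continuous_cos.
apply: cvgM; first exact: cvg_cst.
by apply: cvgB; [exact: cvg_cst|exact: cvg_id].
Qed.

Let continuous_cosx (w t : R) : continuous (fun x : R => cos (w * (x - t))).
Proof.
move=> x; apply: continuous_comp; last exact: continuous_cos.
apply: cvgM; first exact: cvg_cst.
by apply: cvgB; [exact: cvg_id|exact: cvg_cst].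
Qed.

Section integrable.
Variable f : R -> R.
Hypothesis If : mu.-integrable setT (EFin \o f).
Hypothesis f_ge0 : forall x, 0 <= f x.
Hypothesis mass_f : (\int[mu]_x (f x)%:E = 1)%E.

Lemma cos_transform_continuousl t : continuous (cos_transform f t).
Proof.
apply: (continuous_parametric_Rintegral measurableT _ _ _ If).
- by move=> w; apply: continuous_measurable_fun; exact: continuous_cosx.
- by move=> w x; exact: cos_max.
- by move=> x; exact: continuous_cosl.
Qed.

Lemma cos_transform_continuousr w : continuous (fun t => cos_transform f t w).
Proof.
apply: (continuous_parametric_Rintegral measurableT _ _ _ If).
- by move=> t; apply: continuous_measurable_fun; exact: continuous_cosx.
- by move=> t x; exact: cos_max.
- by move=> x; exact: continuous_cosr.
Qed.

Let cos_part w := \int[mu]_x (cos (w * x) * f x).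
Let sin_part w := \int[mu]_x (sin (w * x) * f x).

Let fourier_modulusE w :
  fourier_modulus f w = Num.sqrt (cos_part w ^+ 2 + sin_part w ^+ 2).
Proof. by []. Qed.

Let continuous_mulx (w : R) : continuous ( *%R w).
Proof. exact: mulrl_continuous. Qed.

Let mcos w : measurable_fun setT (fun x : R => cos (w * x)).
Proof.
apply: continuous_measurable_fun => x.
by apply: continuous_comp; [exact: continuous_mulx|exact: continuous_cos].
Qed.

Let msin w : measurable_fun setT (fun x : R => sin (w * x)).
Proof.
apply: continuous_measurable_fun => x.
by apply: continuous_comp; [exact: continuous_mulx|exact: continuous_sin].
Qed.

Lemma continuous_fourier_modulus : continuous (fourier_modulus f).
Proof.
move=> w; rewrite (_ : fourier_modulus f = fun w => Num.sqrt (cos_part w ^+ 2 + sin_part w ^+ 2))//.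
have cc : continuous cos_part.
  apply: (continuous_parametric_Rintegral measurableT _ _ _ If); first exact: mcos.
    by move=> l x; exact: cos_max.
  move=> x l; apply: continuous_comp; last exact: continuous_cos.
  exact: mulrr_continuous.
have cs : continuous sin_part.
  apply: (continuous_parametric_Rintegral measurableT _ _ _ If); first exact: msin.
    by move=> l x; exact: sin_max.
  move=> x l; apply: continuous_comp; last exact: continuous_sin.
  exact: mulrr_continuous.
apply: (@continuous_comp _ _ _ (fun w => cos_part w ^+ 2 + sin_part w ^+ 2)
  (@Num.sqrt R)); last exact: sqrt_continuous.
rewrite /GRing.exp/=; apply: cvgD; apply: cvgM; [exact: cc..|exact: cs|exact: cs].
Qed.

Let Icos w : mu.-integrable setT (EFin \o (fun x => cos (w * x) * f x)).
Proof.
apply: integrable_bounded_mul => //; first exact: mcos.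
by move=> x; exact: cos_max.
Qed.

Let Isin w : mu.-integrable setT (EFin \o (fun x => sin (w * x) * f x)).
Proof.
apply: integrable_bounded_mul => //; first exact: msin.
by move=> x; exact: sin_max.
Qed.

Lemma cos_transformE t w : cos_transform f t w =
  cos (w * t) * cos_part w + sin (w * t) * sin_part w.
Proof.
rewrite /cos_part /sin_part -!RintegralZl// -RintegralD//.
- by apply: eq_Rintegral => x _; rewrite mulrBr cosB; ring.
- exact: (integrableZl measurableT (cos (w * t)) (Icos w)).
- exact: (integrableZl measurableT (sin (w * t)) (Isin w)).
Qed.

(** Cauchy-Schwarz in the plane against the unit vector (cos(wt), sin(wt)), proved by Lagrange's
    identity. *)
Lemma cos_transform_le t w : `|cos_transform f t w| <= fourier_modulus f w.
Proof.
rewrite cos_transformE fourier_modulusE -sqrtr_sqr; apply: ler_wsqrtr.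
have := cos2Dsin2 (w * t).
move: (cos (w * t)) (sin (w * t)) (cos_part w) (sin_part w) => c s p q cs.
rewrite -subr_ge0 (_ : _ - _ = (s * p - c * q) ^+ 2 +
   (1 - (c ^+ 2 + s ^+ 2)) * (p ^+ 2 + q ^+ 2)); last by ring.
by rewrite cs subrr mul0r addr0 sqr_ge0.
Qed.

Lemma Rintegral_mul_le1 (k : R -> R) : measurable_fun setT k ->
  (forall x, `|k x| <= 1) -> `|\int[mu]_x (k x * f x)| <= 1.
Proof.
move=> mk k1; have Ik := @integrable_bounded_mul _ _ _ mu k f setT measurableT mk k1 If.
apply: (le_trans (le_normr_Rintegral measurableT Ik)).
have -> : 1 = \int[mu]_x f x :> R by rewrite /Rintegral mass_f.
apply: le_Rintegral => //; first exact: integrable_norm Ik.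
by move=> x _; rewrite normrM (ger0_norm (f_ge0 x)) ler_piMl.
Qed.

Lemma fourier_modulus_ge0 w : 0 <= fourier_modulus f w.
Proof. exact: sqrtr_ge0. Qed.

(** Each of the two components is at most 1 in absolute value. A crude constant suffices, since it
    serves only for integrability at low frequencies. *)
Lemma fourier_modulus_le2 w : fourier_modulus f w <= 2.
Proof.
rewrite fourier_modulusE -[leRHS](@ger0_norm R)// -sqrtr_sqr ler_wsqrtr//.
have c1 := Rintegral_mul_le1 (mcos w) (fun x => cos_max (w * x)).
have s1 := Rintegral_mul_le1 (msin w) (fun x => sin_max (w * x)).
have c2 : cos_part w ^+ 2 <= 1 by rewrite -real_normK ?num_real// expr_le1.
have s2 : sin_part w ^+ 2 <= 1 by rewrite -real_normK ?num_real// expr_le1.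
lra.
Qed.

Section sobolev.
Variables s L : R.
Hypothesis hs : 1 / 2 < s.
Hypothesis energy_f : (\int[mu]_w
  ((fourier_modulus f w) ^+ 2 * `|w| `^ (2 * s))%:E <= (2 * pi * L ^+ 2)%:E)%E.

Let measurable_modulus (D : set R) : measurable_fun D (fourier_modulus f).
Proof.
apply: measurable_funTS; apply: continuous_measurable_fun.
exact: continuous_fourier_modulus.
Qed.

(* AM-GM with a free weight [l] in place of Cauchy-Schwarz. *)
Lemma integral_fourier_modulus_tail (A l : R) : 0 < A -> 0 < l ->
  (\int[mu]_(w in `[A, +oo[) (fourier_modulus f w)%:E <=
   (l * (pi * L ^+ 2) + l^-1 * (A `^ (1 - 2 * s) / (2 * (2 * s - 1))))%:E)%E.
Proof.
move=> A0 l0.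
pose e w := (fourier_modulus f w) ^+ 2 * `|w| `^ (2 * s).
have me (D : set R) : measurable_fun D e.
  apply: measurable_funM; first exact: measurable_funX.
  by apply: measurable_funTS; apply: (measurableT_comp (measurable_powR _)).
have e_ge0 w : 0 <= e w by rewrite mulr_ge0 ?sqr_ge0 ?powR_ge0.
have mp : measurable_fun `[A, +oo[ (fun w : R => w `^ (- (2 * s))).
  by apply: measurable_funTS; exact: measurable_powR.
apply: (@le_trans _ _ (\int[mu]_(w in `[A, +oo[)
    ((l / 2)%:E * (e w)%:E + (l^-1 / 2)%:E * (w `^ (- (2 * s)))%:E))%E).
  apply: ge0_le_integral => //.
  - by move=> w _; rewrite lee_fin fourier_modulus_ge0.
  - apply/measurable_EFinP; exact: measurable_modulus.
  - apply: emeasurable_funD; apply: emeasurable_funM => //; apply/measurable_EFinP.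
      exact: me.
    exact: mp.
  - move=> w; rewrite /= in_itv/= andbT => Aw.
    have w0 := lt_le_trans A0 Aw.
    rewrite -!EFinM -EFinD lee_fin /e (gtr0_norm w0).
    rewrite (mulrC 2 s) powRN powRrM powR_mulrn ?powR_ge0//.
    have := powR_gt0 s w0; move: (w `^ s) (fourier_modulus f w) => y a y0.
    have y1 : y != 0 by rewrite gt_eqF.
    have l1 : l != 0 by rewrite gt_eqF.
    (* With y = w^s, the inequality a <= l a^2 y^2 / 2 + 1 / (2 l y^2) is a completed square. *)
    rewrite -subr_ge0 (_ : _ - _ = (2 * l)^-1 * (l * a * y - y^-1) ^+ 2).
      by rewrite mulr_ge0 ?sqr_ge0// invr_ge0 mulr_ge0// ltW.
    by field; rewrite y1 l1.
rewrite ge0_integralD//; last 4 first.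
- by move=> w _; rewrite -EFinM lee_fin mulr_ge0// divr_ge0// ltW.
- by apply: emeasurable_funM => //; apply/measurable_EFinP; exact: me.
- by move=> w _; rewrite -EFinM lee_fin mulr_ge0 ?powR_ge0// divr_ge0// invr_ge0 ltW.
- by apply: emeasurable_funM => //; apply/measurable_EFinP; exact: mp.
rewrite ge0_integralZl//; last 3 first.
- by apply/measurable_EFinP; exact: me.
- by move=> w _; rewrite lee_fin.
- by rewrite lee_fin divr_ge0// ltW.
rewrite ge0_integralZl//; last 3 first.
- by apply/measurable_EFinP; exact: mp.
- by move=> w _; rewrite lee_fin powR_ge0.
- by rewrite lee_fin divr_ge0// invr_ge0 ltW.
rewrite integral_powR_tail//; last by move: hs; lra.
rewrite EFinD; apply: leeD; last first.
  rewrite -EFinM lee_fin le_eqVlt; apply/orP; left; apply/eqP.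
  have s1 : 2 * s - 1 != 0 by move: hs => ?; apply/eqP; lra.
  by field; rewrite s1 gt_eqF.
have -> : (l * (pi * L ^+ 2))%:E = ((l / 2)%:E * (2 * pi * L ^+ 2)%:E)%E.
  by rewrite -EFinM; congr EFin; field.
rewrite lee_pmul2l ?lte_fin ?divr_gt0//.
apply: le_trans energy_f; apply: ge0_subset_integral => //.
- by apply/measurable_EFinP; exact: me.
- by move=> w _; rewrite lee_fin.
Qed.

(** The weight |w|^(2s) vanishes at the origin, so the energy gives control only away from it: below
    1 the uniform bound is used, beyond 1 the tail estimate with [A = l = 1]. *)
Lemma integrable_fourier_modulus :
  mu.-integrable `[0%R, +oo[ (EFin \o fourier_modulus f).
Proof.
apply/integrableP; split; first by apply/measurable_EFinP; exact: measurable_modulus.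
under eq_integral do rewrite /= (ger0_norm (fourier_modulus_ge0 _)).
rewrite (_ : `[0%R, +oo[%classic = `[0%R, 1[ `|` `[1%R, +oo[); last first.
  by rewrite -itv_bndbnd_setU ?bnd_simp.
rewrite ge0_integral_setU//=.
- apply: lte_add_pinfty.
    apply: (@le_lt_trans _ _ (\int[mu]_(w in `[0%R, 1%R[) (cst 2%:E) w)%E).
      apply: ge0_le_integral => //.
      + by move=> w _; rewrite lee_fin fourier_modulus_ge0.
      + apply/measurable_EFinP; exact: measurable_modulus.
      + by move=> w _; rewrite lee_fin fourier_modulus_le2.
    by rewrite integral_cst//= lebesgue_measure_itv/= lte_fin ltr01 sube0 -EFinM ltry.
  by apply: le_lt_trans (integral_fourier_modulus_tail ltr01 ltr01) _; rewrite ltry.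
- by apply/measurable_EFinP; exact: measurable_modulus.
- by move=> w _; rewrite lee_fin fourier_modulus_ge0.
- apply/disj_setPS => w [] /=; rewrite !in_itv/= andbT => /andP[_ w1].
  by rewrite leNgt w1.
Qed.

Lemma integrable_cos_transform t :
  mu.-integrable `[0%R, +oo[ (EFin \o cos_transform f t).
Proof.
apply: (le_integrable _ _ _ integrable_fourier_modulus) => //.
- apply/measurable_EFinP; apply: measurable_funTS.
  apply: continuous_measurable_fun; exact: cos_transform_continuousl.
- move=> w _; rewrite lee_fin (ger0_norm (fourier_modulus_ge0 _)).
  exact: cos_transform_le.
Qed.

Definition inverse_fourier t : R :=
  pi^-1 * \int[mu]_(w in `[0%R, +oo[) cos_transform f t w.

Lemma continuous_inverse_fourier : continuous inverse_fourier.
Proof.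
move=> t; apply: cvgM; first exact: cvg_cst.
have := @continuity_under_integral R _ _ mu (cos_transform f) `[0%R, +oo[
  _ (t - 1) (t + 1) _ _ (fourier_modulus f) _ _ t.
apply => //.
- by move=> x _; exact: integrable_cos_transform.
- by apply: aeW => w _ l _; exact: cos_transform_continuousr.
- exact: integrable_fourier_modulus.
- by move=> x _; apply: aeW => w _; exact: cos_transform_le.
- by rewrite inE/= in_itv/= ltrBlDr ltrDl andbb ltr01.
Qed.

Lemma smoothed_densityE (h t : R) : 0 < h ->
  \int[mu]_x (scaled_kernel (@sinc_kernel R) h (x - t) * f x) =
  pi^-1 * \int[mu]_(w in `[0, pi / h]) cos_transform f t w.
Proof.
move=> h0.
have pi0 : (pi : R) != 0 by rewrite gt_eqF ?pi_gt0.
have hV0 : h^-1 != 0 by rewrite invr_eq0 gt_eqF.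
(* The scaled kernel is bounded by 1/h, while [integrable_bounded_mul] asks for 1; the factor [h] is
   inserted here and cancelled at the end. *)
have mK : measurable_fun setT (fun x : R => h * scaled_kernel (@sinc_kernel R) h (x - t)).
  apply: measurable_funM => //; apply: continuous_measurable_fun.
  exact: continuous_scaled_sinc.
have K1 (x : R) : `|h * scaled_kernel (@sinc_kernel R) h (x - t)| <= 1.
  rewrite normrM (gtr0_norm h0) -(@mulfV _ h) ?gt_eqF// ler_pM2l//.
  exact: scaled_sinc_le.
have IK := @integrable_bounded_mul _ _ _ mu _ f setT measurableT mK K1 If.
have -> : \int[mu]_(w in `[0, pi / h]) cos_transform f t w =
  \int[mu]_(w in `[0, pi / h]) (1 * \int[mu]_x (cos (w * (x - t)) * f x)).
  by apply: eq_Rintegral => w _; rewrite mul1r.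
rewrite (@Rintegral_kernel_swap _ `[0, pi / h]
  (fun z => cos (z.1 * (z.2 - t))) (cst 1) f)//; last 3 first.
- apply: (measurableT_comp (f := @cos R)).
    by apply: continuous_measurable_fun; exact: continuous_cos.
  apply: measurable_funM; first exact: measurable_fst.
  by apply: measurable_funB => //; exact: measurable_snd.
- by move=> z; exact: cos_max.
- apply/integrableP; split; first exact/measurable_EFinP.
  under eq_integral do rewrite /= normr1.
  rewrite integral_cst//= lebesgue_measure_itv/=.
  by case: ifP => _; rewrite mul1e ltry.
have E (x : R) : (\int[mu]_(w in `[0, pi / h]) (cos (w * (x - t)) * cst 1 w)) * f x
    = (pi / h) * (h * scaled_kernel (@sinc_kernel R) h (x - t) * f x).
  rewrite -(mulrA h) mulrA divfK ?gt_eqF// mulrA -integral_cos_sinc//.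
  congr (_ * _).
  by apply: eq_Rintegral => w _; rewrite mulr1.
under [in RHS]eq_Rintegral do rewrite E.
rewrite RintegralZl// mulrA mulrA mulVf// mul1r -RintegralZl//.
by apply: eq_Rintegral => x _; rewrite !mulrA mulVf ?mul1r// gt_eqF.
Qed.

(** The weight [l] stays free here; its value as a power of [h] is fixed in [sobolev_bias]. *)
Lemma smoothed_density_bias (h t l : R) : 0 < h -> 0 < l ->
  `|\int[mu]_x (scaled_kernel (@sinc_kernel R) h (x - t) * f x)
    - inverse_fourier t| <=
  pi^-1 * (l * (pi * L ^+ 2)
    + l^-1 * ((pi / h) `^ (1 - 2 * s) / (2 * (2 * s - 1)))).
Proof.
move=> h0 l0; have pih0 : 0 < pi / h by rewrite divr_gt0 ?pi_gt0.
rewrite smoothed_densityE// /inverse_fourier -mulrBr normrM.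
rewrite ger0_norm ?invr_ge0 ?pi_ge0// ler_wpM2l ?invr_ge0 ?pi_ge0//.
have Ic := integrable_cos_transform t.
have It : mu.-integrable `]pi / h, +oo[ (EFin \o cos_transform f t).
  apply: integrableS Ic => // x; rewrite /= !in_itv/= !andbT => /ltW.
  by apply: le_trans; exact: ltW.
(* Both integrals agree up to frequency pi / h, so only the tail survives. *)
rewrite (_ : `[0%R, +oo[%classic = `[0%R, pi / h] `|` `]pi / h, +oo[); last first.
  by rewrite -itv_bndbnd_setU ?bnd_simp ?(ltW pih0).
rewrite Rintegral_setU//; last 2 first.
- by rewrite -itv_bndbnd_setU ?bnd_simp ?(ltW pih0).
- apply/disj_setPS => w [] /=; rewrite !in_itv/= andbT => /andP[_ w1].
  by rewrite ltNge w1.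
rewrite opprD addrA subrr add0r normrN -lee_fin EFin_normr_Rintegral//.
apply: le_trans (integral_fourier_modulus_tail pih0 l0).
apply: (le_trans (le_abse_integral _ _ _)) => //; first exact: measurable_int It.
apply: (@le_trans _ _ (\int[mu]_(w in `](pi / h)%R, +oo[) (fourier_modulus f w)%:E)%E).
  apply: ge0_le_integral => //.
  - by apply: measurableT_comp => //; exact: measurable_int It.
  - by apply/measurable_EFinP; exact: measurable_modulus.
  - by move=> w _; rewrite lee_fin cos_transform_le.
apply: ge0_subset_integral => //.
- by apply/measurable_EFinP; exact: measurable_modulus.
- by move=> w _; rewrite lee_fin fourier_modulus_ge0.
- by move=> x; rewrite /= !in_itv/= !andbT => /ltW.
Qed.
End sobolev.
End integrable.
End cos_transform.

(** * Fourier inversion *)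

Section inversion.
Context {R : realType}.
Notation mu := (@lebesgue_measure R).
Variables (f : R -> R) (s L : R).
Hypothesis If : mu.-integrable setT (EFin \o f).
Hypothesis f_ge0 : forall x, 0 <= f x.
Hypothesis mass_f : (\int[mu]_x (f x)%:E = 1)%E.
Hypothesis hs : 1 / 2 < s.
Hypothesis energy_f : (\int[mu]_w
  ((fourier_modulus f w) ^+ 2 * `|w| `^ (2 * s))%:E <= (2 * pi * L ^+ 2)%:E)%E.

Let mf : measurable_fun setT f.
Proof. by apply/measurable_EFinP; exact: measurable_int If. Qed.

(** The exponential is the integrable weight in w that makes the exchange of integrals
    legitimate. *)
Lemma poisson_smoothing (e t : R) : 0 < e ->
  \int[mu]_(w in `[0%R, +oo[) (expR (- (e * w)) * cos_transform f t w) =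
  \int[mu]_x (e / (e ^+ 2 + (x - t) ^+ 2) * f x).
Proof.
move=> e0.
rewrite (@Rintegral_kernel_swap _ `[0%R, +oo[
  (fun z => cos (z.1 * (z.2 - t))) (fun w => expR (- (e * w))) f)//; last 3 first.
- apply: (measurableT_comp (f := @cos R)).
    by apply: continuous_measurable_fun; exact: continuous_cos.
  apply: measurable_funM; first exact: measurable_fst.
  by apply: measurable_funB => //; exact: measurable_snd.
- by move=> z; exact: cos_max.
- exact: integrable_expRN.
by apply: eq_Rintegral => x _; rewrite -integral_cos_expRN.
Qed.

Lemma integral_poisson_smoothing (e a b : R) : 0 < e -> a < b ->
  \int[mu]_(t in `[a, b]) (\int[mu]_x (e / (e ^+ 2 + (x - t) ^+ 2) * f x)) =
  \int[mu]_x ((atan ((b - x) / e) - atan ((a - x) / e)) * f x).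
Proof.
move=> e0 ab; have e1 : e != 0 by rewrite gt_eqF.
(* This is [e] times the kernel of the statement, normalized to be at most 1; the missing factor
   [e^-1] becomes the constant weight on [a, b]. *)
pose k (z : R * R) : R := (1 + ((z.2 - z.1) / e) ^+ 2)^-1.
have D0 (y : R) : 0 < 1 + y ^+ 2 by rewrite ltr_pwDl ?sqr_ge0.
have kE (t x : R) : k (t, x) * e^-1 = e / (e ^+ 2 + (x - t) ^+ 2).
  have E : e ^+ 2 + (x - t) ^+ 2 = e ^+ 2 * (1 + ((x - t) / e) ^+ 2) by field.
  rewrite /k E; have := lt0r_neq0 (D0 ((x - t) / e)); move: (1 + _) => q q0.
  by field; rewrite e1 q0.
have mk : measurable_fun setT k.
  apply: (measurableT_comp (f := fun y : R => (1 + y ^+ 2)^-1)).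
    apply: continuous_measurable_fun; exact: continuous_oneDsqrV.
  apply: measurable_funM => //; apply: measurable_funB.
    exact: measurable_snd.
  exact: measurable_fst.
have k1 z : `|k z| <= 1.
  rewrite ger0_norm ?invr_ge0 ?(ltW (D0 _))//.
  rewrite -[leRHS]invr1 lef_pV2 ?posrE ?D0//.
  by rewrite lerDl sqr_ge0.
have Ie : mu.-integrable `[a, b] (EFin \o cst e^-1).
  apply/integrableP; split; first exact/measurable_EFinP.
  under eq_integral do rewrite /=.
  rewrite integral_cst//= lebesgue_measure_itv/=.
  by case: ifP => _; rewrite ?mule0 -?EFinM ltry.
have H := Rintegral_kernel_swap (measurable_itv `[a, b]) mk k1 Ie If.
transitivity (\int[mu]_(w in `[a, b]) (cst e^-1 w * \int[mu]_x (k (w, x) * f x))).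
  apply: eq_Rintegral => t _.
  have Ik := @integrable_bounded_mul _ _ _ mu (fun x => k (t, x)) f setT
    measurableT (measurableT_comp mk (pair1_measurable t)) (fun x => k1 (t, x)) If.
  rewrite -RintegralZl//; apply: eq_Rintegral => x _.
  by rewrite /= -kE mulrA (mulrC e^-1).
rewrite {}H; apply: eq_Rintegral => x _; congr (_ * _).
rewrite /Rintegral -[RHS]/(fine _%:E) -integral_poisson//.
by congr fine; apply: eq_integral => t _; rewrite kE.
Qed.

Let Imod := integrable_fourier_modulus If f_ge0 mass_f hs energy_f.

Let e_ n : R := n.+1%:R^-1.
Let e_gt0 n : 0 < e_ n. Proof. by rewrite invr_gt0. Qed.

Let cvg_e_ : e_ n @[n --> \oo] --> 0.
Proof. exact: cvg_harmonic. Qed.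

(* Abel means of the inversion integral; by [poisson_smoothing] they are also
   the convolutions of [f] with the Poisson kernel. *)
Let abel n t := \int[mu]_(w in `[0%R, +oo[) (expR (- (e_ n * w)) * cos_transform f t w).

Let expN_le1 n (w : R) : 0 <= w -> `|expR (- (e_ n * w))| <= 1.
Proof.
by move=> w0; rewrite ger0_norm ?expR_ge0// -expR0 ler_expR oppr_le0 mulr_ge0// ltW.
Qed.

Let abel_integrand_le n (t w : R) : 0 <= w ->
  `|expR (- (e_ n * w)) * cos_transform f t w| <= fourier_modulus f w.
Proof.
move=> w0; rewrite normrM (le_trans _ (cos_transform_le If t w))//.
by rewrite ler_piMl// expN_le1.
Qed.

(** The Fourier modulus dominates all the damped integrands at once, and it is integrable by the
    Sobolev condition. *)
Let cvg_abel t : abel n t @[n --> \oo] --> pi * inverse_fourier f t.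
Proof.
rewrite /inverse_fourier mulrA mulfV ?gt_eqF ?pi_gt0// mul1r.
have mc : measurable_fun (`[0%R, +oo[ : set R) (cos_transform f t).
  by apply: measurable_funTS; apply: continuous_measurable_fun; exact: cos_transform_continuousl.
apply: (Rintegral_dominated_convergence _ _ _ _ Imod) => //.
- move=> n; apply: measurable_funM => //; apply: measurable_funTS.
  apply: continuous_measurable_fun; exact: continuous_expRN.
- move=> w _; rewrite -[X in _ --> X]mul1r; apply: cvgM; last exact: cvg_cst.
  rewrite -expR0; apply: continuous_cvg; first exact: continuous_expR.
  rewrite -oppr0 -[in X in _ --> X](mul0r w); apply: cvgN; apply: cvgM => //.
  exact: cvg_cst.
- by move=> n w; rewrite /= in_itv/= andbT => w0; exact: abel_integrand_le.
Qed.

Let Iabel n t : mu.-integrable `[0%R, +oo[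
  (EFin \o (fun w => expR (- (e_ n * w)) * cos_transform f t w)).
Proof.
apply: (le_integrable _ _ _ Imod) => //.
- apply/measurable_EFinP; apply: measurable_funM; apply: measurable_funTS;
    apply: continuous_measurable_fun; first exact: continuous_expRN.
  exact: cos_transform_continuousl.
- move=> w; rewrite /= in_itv/= andbT => w0.
  rewrite lee_fin (ger0_norm (fourier_modulus_ge0 _ _)).
  exact: abel_integrand_le.
Qed.

Let abel_le n t : `|abel n t| <= \int[mu]_(w in `[0%R, +oo[) fourier_modulus f w.
Proof.
apply: (le_trans (le_normr_Rintegral _ (Iabel n t))) => //.
apply: le_Rintegral => //; first exact: (integrable_norm (Iabel n t)).
by move=> w; rewrite /= in_itv/= andbT => w0; exact: abel_integrand_le.
Qed.

Let mg : measurable_fun setT (inverse_fourier f).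
Proof.
by apply: continuous_measurable_fun; exact: continuous_inverse_fourier energy_f.
Qed.

Let continuous_abel n : continuous (abel n).
Proof.
move=> t.
have := @continuity_under_integral R _ _ mu
  (fun t w => expR (- (e_ n * w)) * cos_transform f t w) `[0%R, +oo[
  _ (t - 1) (t + 1) _ _ (fourier_modulus f) _ _ t.
apply => //.
- apply: aeW => w _ l _; apply: cvgM; first exact: cvg_cst.
  exact: cos_transform_continuousr.
- move=> x _; apply: aeW => w; rewrite /= in_itv/= andbT => w0.
  exact: abel_integrand_le.
- by rewrite inE/= in_itv/= ltrBlDr ltrDl andbb ltr01.
Qed.

(** Applied with [c = b - x] and [c = a - x]; the sign function treats the two sides and the
    endpoints of [a, b] uniformly, since [Num.sg 0 = 0] matches [atan 0 = 0]. *)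
Let cvg_atan_scaled (c : R) : atan (c / e_ n) @[n --> \oo] --> pi / 2 * Num.sg c.
Proof.
have pos (d : R) : 0 < d -> atan (d / e_ n) @[n --> \oo] --> pi / 2.
  move=> d0.
  apply: (@cvg_comp _ _ _ (fun n => d / e_ n) atan _ (pinfty_nbhs R)); last exact: cvgy_atan.
  apply/cvgryPge => A; near=> n.
  rewrite /e_ invrK mulrC -ler_pdivrMr// (@le_trans _ _ n%:R) ?ler_nat//.
  by near: n; exact: nbhs_infty_ger.
case: (ltrgtP c 0) => [c0|c0|->].
- rewrite ltr0_sg// mulrN1.
  rewrite (_ : (fun n => _) = (fun n => - atan ((- c) / e_ n))).
    by apply: cvgN; apply: pos; rewrite oppr_gt0.
  by apply/funext => n; rewrite mulNr atanN opprK.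
- by rewrite gtr0_sg// mulr1; exact: pos.
- rewrite sgr0 mulr0 (_ : (fun n => _) = cst 0); first exact: cvg_cst.
  by apply/funext => n; rewrite mul0r atan0.
Unshelve. all: by end_near. Qed.

Lemma integral_inverse_fourier (a b : R) : a < b ->
  \int[mu]_(t in `[a, b]) inverse_fourier f t = \int[mu]_(t in `[a, b]) f t.
Proof.
move=> ab.
have pi0 : (pi : R) != 0 by rewrite gt_eqF ?pi_gt0.
have cst_int (c : R) : mu.-integrable `[a, b] (EFin \o cst c).
  apply/integrableP; split; first exact/measurable_EFinP.
  under eq_integral do rewrite /=.
  rewrite integral_cst//= lebesgue_measure_itv/=.
  by case: ifP => _; rewrite ?mule0 -?EFinM ltry.
(* The interval is bounded, so the uniform bound [abel_le] is an integrable majorant. *)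
have lhs : \int[mu]_(t in `[a, b]) abel n t @[n --> \oo] -->
    \int[mu]_(t in `[a, b]) (pi * inverse_fourier f t).
  apply: (Rintegral_dominated_convergence _ _ _ _ (cst_int _)) => //.
  - by move=> n; apply: measurable_funTS; exact: continuous_measurable_fun.
  - by apply: measurable_funM => //; exact: measurable_funTS.
  - by move=> n x _; exact: abel_le.
(* The limit is [pi * f x] inside [a, b] and [0] outside. *)
pose lim x := (pi / 2 * (Num.sg (b - x) - Num.sg (a - x))) * f x.
have matan (c e : R) : measurable_fun setT (fun x : R => atan ((c - x) / e)).
  apply: (measurableT_comp (f := @atan R)).
    by apply: continuous_measurable_fun => x; exact: continuous_atan.
  by apply: measurable_funM => //; exact: measurable_funB.
have cvg_lim_ x : (atan ((b - x) / e_ n) - atan ((a - x) / e_ n)) * f x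
    @[n --> \oo] --> lim x.
  by apply: cvgM; [rewrite mulrBr; exact: cvgB|exact: cvg_cst].
have matan2 n : measurable_fun setT
    (fun x : R => (atan ((b - x) / e_ n) - atan ((a - x) / e_ n)) * f x).
  by apply: measurable_funM => //; exact: measurable_funB.
have mlim : measurable_fun setT lim.
  exact: (measurable_fun_cvg matan2 (fun x _ => cvg_lim_ x)).
(* Two arctangents differ by at most pi, so [pi * f] dominates. *)
have rhs : \int[mu]_(t in `[a, b]) abel n t @[n --> \oo] --> \int[mu]_x lim x.
  under eq_fun => n.
    under eq_Rintegral do rewrite /abel poisson_smoothing//.
    rewrite integral_poisson_smoothing//.
    over.
  have Ipi : mu.-integrable setT (EFin \o (fun x => pi * f x)).
    exact: (integrableZl measurableT pi If).
  apply: (Rintegral_dominated_convergence _ _ _ _ Ipi) => //.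
  - move=> n x _; rewrite normrM (ger0_norm (f_ge0 x)) ler_wpM2r//.
    apply: (le_trans (ler_normB _ _)).
    have H (y : R) : `|atan y| <= pi / 2.
      by rewrite ler_norml !ltW// ?atan_gtNpi2 ?atan_ltpi2.
    by rewrite (le_trans (lerD (H _) (H _)))// -splitr.
have E := cvg_unique (@Rhausdorff R) lhs rhs.
have {E}E : pi * \int[mu]_(t in `[a, b]) inverse_fourier f t =
    pi * \int[mu]_(t in `[a, b]) f t.
  rewrite -RintegralZl//; last first.
    apply: continuous_compact_integrable; first exact: segment_compact.
    by apply: continuous_subspaceT; exact: continuous_inverse_fourier energy_f.
  rewrite -RintegralZl//; last exact: integrableS If.
  rewrite [LHS]E [RHS]Rintegral_mkcond /Rintegral; congr fine.
  apply: ae_eq_integral => //.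
  - exact/measurable_EFinP.
  - apply/measurable_EFinP/(measurable_restrictT _ _).1 => //.
    by apply: measurable_funTS; exact: measurable_funM.
  (* At an endpoint one of the signs is 0 and [lim] is only half of [pi * f]; these two points form
     a null set. *)
  exists [set a; b]; split => //.
  - by apply: measurableU; exact: measurable_set1.
  - by apply: countable_lebesgue_measure0; apply: finite_set_countable.
  - move=> x /= /not_implyP[_]; apply: contra_notP => /not_orP[/eqP xa /eqP xb].
    congr EFin; rewrite patchE mem_setE in_itv/= /lim.
    have [xa'|xa'|xa'] := ltrgtP x a; last by rewrite xa' eqxx in xa.
      rewrite !gtr0_sg ?subr_gt0//; last exact: lt_trans xa' ab.
      by rewrite subrr mulr0 mul0r.
    rewrite (ltr0_sg (x := a - x)) ?subr_lt0//.
    have [xb'|xb'|xb'] := ltrgtP x b; last by rewrite xb' eqxx in xb.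
      by rewrite gtr0_sg ?subr_gt0// opprK -mulrA mulrA divfK.
    by rewrite ltr0_sg ?subr_lt0// subrr mulr0 mul0r.
by have /mulfI := pi0; apply.
Qed.

Lemma ae_eq_inverse_fourier : {ae mu, forall x, f x = inverse_fourier f x}.
Proof.
have cg : continuous (inverse_fourier f).
  exact: (continuous_inverse_fourier If f_ge0 mass_f hs energy_f).
have locf : locally_integrable [set: R] f.
  by have := integrable_locally measurableT If; rewrite patch_setT.
(* The primitives start at the finite endpoint [- n], which reaches only the points to its right;
   the countably many exceptional null sets are united afterwards. *)
have H n : {ae mu, forall x : R, - n%:R < x -> f x = inverse_fourier f x}.
  have Ify y : mu.-integrable [set` Interval (BLeft (- n%:R)) (BRight y)] (EFin \o f).
    exact: integrableS If.
  have := FTC1 Ify locf.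
  apply: filterS; first exact: (ae_filter_ringOfSetsType mu).
  move=> x /= + nx.
  have ax : ((- n%:R)%:E < x%:E)%E by rewrite lte_fin.
  move=> /(_ ax)[_ <-].
  have Ig : mu.-integrable `[- n%:R, x + 1] (EFin \o inverse_fourier f).
    apply: continuous_compact_integrable; first exact: segment_compact.
    exact: continuous_subspaceT.
  have x1 : x < x + 1 by rewrite ltrDl.
  have [_ <-] := continuous_FTC1_closed x1 Ig nx (cg x).
  (* The primitives must agree as functions of [y], hence also for [y <= - n], where both integrals
     vanish. *)
  congr (derive1 _ x); apply/funext => y.
  have [ny|] := ltP (- n%:R) y; first by rewrite -integral_inverse_fourier.
  rewrite le_eqVlt => /predU1P[->|yn]; first by rewrite set_itv1 !Rintegral_set1.
  by rewrite set_itv_ge ?bnd_simp -?ltNge// !Rintegral_set0.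
have : {ae mu, forall x (n : nat), - n%:R < x -> f x = inverse_fourier f x}.
  exact: ae_foralln.
apply: filterS; first exact: (ae_filter_ringOfSetsType mu).
move=> x Hx; apply: (Hx (Num.bound `|x|)).
by rewrite ltrNl; apply: le_lt_trans (archi_boundP (normr_ge0 x)); rewrite -normrN ler_norm.
Qed.

(** A continuous version is unique: two of them that differ at a point differ on a ball around it,
    which has positive measure, whereas they agree almost everywhere. Hence the choice in
    [continuous_version] is determined. *)
Lemma continuous_versionE : continuous_version f = inverse_fourier f.
Proof.
have cg : continuous (inverse_fourier f).
  exact: (continuous_inverse_fourier If f_ge0 mass_f hs energy_f).
have [cG fG] : continuous (continuous_version f) /\
    {ae mu, forall x, f x = continuous_version f x}.
  apply: (@getPex _ [set g : R -> R | continuous g /\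
    {ae mu, forall x, f x = g x}]).
  by exists (inverse_fourier f); split => //; exact: ae_eq_inverse_fourier.
have [N [mN N0 sN]] : {ae mu, forall x, continuous_version f x = inverse_fourier f x}.
  apply: filterS2 fG ae_eq_inverse_fourier; first exact: (ae_filter_ringOfSetsType mu).
  by move=> x <- <-.
apply/funext => t; apply: contrapT => /eqP tn.
have : \forall x \near t, continuous_version f x - inverse_fourier f x != 0.
  have C : continuous_version f x - inverse_fourier f x @[x --> t] -->
      continuous_version f t - inverse_fourier f t.
    by apply: cvgB; [exact: cG|exact: cg].
  by apply: (@cvgr_neq0 R R^o _ _ _ _ _ C); rewrite subr_eq0.
move=> [e /= e0 He].
have : (mu (ball t e) <= mu N)%E.
  apply: le_measure; rewrite ?inE//; first exact: measurable_ball.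
  move=> x /He; rewrite subr_eq0 => /eqP xn; exact: sN.
by rewrite N0 lebesgue_measure_ball ?(ltW e0)// lee_fin leNgt mulrn_wgt0.
Qed.
End inversion.

(** * Densities and independence *)

Section density.
Context d (T : measurableType d) (R : realType) (P : probability T R).
Notation mu := (@lebesgue_measure R).

Section one.
Variables (X : {RV P >-> R}) (f : R -> R).
Hypothesis mf : measurable_fun setT f.
Hypothesis Xf : forall B, measurable B ->
  distribution P X B = (\int[mu]_(x in B) (f x)%:E)%E.

Let mX : measurable_fun setT (X : T -> measurableTypeR R).
Proof. exact: (measurable_funPT X). Qed.

Let X' : {RV P >-> measurableTypeR R} :=
  HB.pack (X : T -> measurableTypeR R) (isMeasurableFun.Build _ _ _ _ _ mX).

Let nu : {finite_measure set (measurableTypeR R) -> \bar R} := distribution P X'.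

Let nuE A : measurable A -> nu A = (\int[mu]_(x in A) (f x)%:E)%E.
Proof. by move=> mA; exact: Xf. Qed.

Let nu_mu : nu `<< mu.
Proof.
apply/null_content_dominatesP => A mA A0.
rewrite nuE//; apply: null_set_integral => //.
by apply: measurable_funTS; exact/measurable_EFinP.
Qed.

Lemma ge0_integral_density (phi : R -> R) : measurable_fun setT phi ->
  (forall x, 0 <= phi x) ->
  (\int[P]_w (phi (X w))%:E = \int[mu]_x (phi x * f x)%:E)%E.
Proof.
move=> mphi phi0.
rewrite -(@ge0_integral_distribution _ _ _ _ _ P X' (EFin \o phi))//; last exact/measurable_EFinP.
have := @Radon_Nikodym_SigmaFinite.change_of_variables _ _ R nu mu nu_mu
  (EFin \o phi) setT _ measurableT _.
move=> <-//; last exact/measurable_EFinP.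
(* The Radon-Nikodym derivative of the law and [f] have the same integral over every measurable
   set. *)
have rnf : ae_eq mu setT (Radon_Nikodym_SigmaFinite.f nu mu) (EFin \o f).
  apply: integral_ae_eq => //.
  - exact: Radon_Nikodym_SigmaFinite.f_integrable.
  - exact/measurable_EFinP.
  - by move=> E _ mE; rewrite -Radon_Nikodym_SigmaFinite.f_integral// nuE.
apply: ae_eq_integral => //.
- apply: emeasurable_funM; first exact/measurable_EFinP.
  exact: measurable_int (Radon_Nikodym_SigmaFinite.f_integrable nu_mu).
- by apply/measurable_EFinP; exact: measurable_funM.
- case: rnf => N [mN N0 sN]; exists N; split => //.
  by apply: subset_trans sN; apply: subsetC => x /= H _; rewrite H.
Qed.

Lemma integral_density (phi : R -> R) : (forall x, 0 <= f x) ->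
  measurable_fun setT phi ->
  (\int[P]_w (phi (X w))%:E = \int[mu]_x (phi x * f x)%:E)%E.
Proof.
move=> f_ge0 mphi.
rewrite integralE [RHS]integralE; congr (_ - _)%E.
- transitivity (\int[P]_w (phi^\+ (X w))%:E)%E.
    by apply: eq_integral => w _; rewrite funeposE EFin_max.
  rewrite ge0_integral_density//; last exact: measurable_funrpos.
  apply: eq_integral => x _; rewrite funeposE /funrpos -EFin_max; congr EFin.
  by rewrite maxr_pMl ?mul0r.
- transitivity (\int[P]_w (phi^\- (X w))%:E)%E.
    by apply: eq_integral => w _; rewrite funenegE EFin_max.
  rewrite ge0_integral_density//; last exact: measurable_funrneg.
  apply: eq_integral => x _; rewrite funenegE /funrneg -EFin_max; congr EFin.
  by rewrite maxr_pMl ?mul0r ?mulNr.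
Qed.
End one.

Lemma expectationM_independent (X Y : T -> R) :
  measurable_fun setT X -> measurable_fun setT Y ->
  P.-integrable setT (EFin \o X) -> P.-integrable setT (EFin \o Y) ->
  (forall A B, measurable A -> measurable B ->
    P (X @^-1` A `&` Y @^-1` B) = P (X @^-1` A) * P (Y @^-1` B))%E ->
  ('E_P[X \* Y] = 'E_P[X] * 'E_P[Y])%E.
Proof.
move=> mX mY IX IY XY.
pose X' : {RV P >-> R} := HB.pack X (isMeasurableFun.Build _ _ _ _ X mX).
pose Y' : {RV P >-> R} := HB.pack Y (isMeasurableFun.Build _ _ _ _ Y mY).
have mXY : measurable_fun setT (fun w => (X w, Y w)).
  exact: measurable_fun_pair.
pose Z : {RV P >-> (R * R)%type} :=
  HB.pack (fun w => (X w, Y w)) (isMeasurableFun.Build _ _ _ _ _ mXY).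
pose mX' : probability R R := distribution P X'.
pose mY' : probability R R := distribution P Y'.
have mm : measurable_fun setT (fun z : R * R => (z.1 * z.2)%:E).
  apply/measurable_EFinP; apply: measurable_funM.
    exact: measurable_fst.
  exact: measurable_snd.
(* Independence says that the joint law has product values on rectangles, and these determine the
   product measure. The claim thereby reduces to Fubini. *)
have ZE A : measurable A -> distribution P Z A = (mX' \x mY')%E A.
  by move=> mA; apply/esym; apply: product_measure_unique.
have absX : (\int[mX']_x `|x|%:E = \int[P]_w `|X w|%:E)%E.
  rewrite (@ge0_integral_distribution _ _ _ _ _ P X' (fun x => `|x|%:E))//.
  exact/measurable_EFinP.
have absY : (\int[mY']_x `|x|%:E = \int[P]_w `|Y w|%:E)%E.
  rewrite (@ge0_integral_distribution _ _ _ _ _ P Y' (fun x => `|x|%:E))//.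
  exact/measurable_EFinP.
have [_ fX] := integrableP _ _ _ IX.
have [_ fY] := integrableP _ _ _ IY.
have Imm : ((mX' \x mY')%E).-integrable setT (fun z : R * R => (z.1 * z.2)%:E).
  apply/(integrable12ltyP mX' mY' mm) => /=.
  under eq_integral => x _.
    under eq_integral do rewrite normrM EFinM.
    rewrite ge0_integralZl//=; last first.
      exact/measurable_EFinP.
    over.
  rewrite ge0_integralZr//=.
  - by rewrite absX absY lte_mul_pinfty ?integral_ge0// ge0_fin_numE// integral_ge0.
  - exact/measurable_EFinP.
  - exact: integral_ge0.
have IX' : mX'.-integrable setT (EFin \o id).
  apply/integrableP; split; first exact/measurable_EFinP.
  by rewrite /= absX.
have IY' : mY'.-integrable setT (EFin \o id).
  apply/integrableP; split; first exact/measurable_EFinP.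
  by rewrite /= absY.
have EX : (\int[mX']_x x%:E = 'E_P[X])%E.
  rewrite (@integral_distribution _ _ _ _ _ P X' (EFin \o id))//; last exact/measurable_EFinP.
  by rewrite unlock.
have EY : (\int[mY']_x x%:E = 'E_P[Y])%E.
  rewrite (@integral_distribution _ _ _ _ _ P Y' (EFin \o id))//; last exact/measurable_EFinP.
  by rewrite unlock.
transitivity (\int[mX' \x mY']_z (z.1 * z.2)%:E)%E.
  rewrite (eq_measure_integral (distribution P Z)); last first.
    by move=> A mA _; exact/esym/ZE.
  rewrite integral_distribution//.
    by rewrite unlock.
  have mm' : measurable_fun setT (fun z : R * R => `|z.1 * z.2|%:E).
    by apply/measurable_EFinP; apply: measurableT_comp => //; exact/measurable_EFinP.
  apply/integrableP; split.
    by apply/measurable_EFinP; exact: measurable_funM.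
  have [_] := integrableP _ _ _ Imm; apply: le_lt_trans.
  rewrite -(@ge0_integral_distribution _ _ _ _ _ P Z (fun z => `|z.1 * z.2|%:E))//.
  rewrite le_eqVlt; apply/orP; left; apply/eqP.
  apply: eq_measure_integral => A mA _; exact: ZE.
rewrite -(integral12_prod_meas1 Imm) /fubini_F/=.
under eq_integral => x _.
  under eq_integral do rewrite EFinM.
  rewrite integralZl//.
  rewrite EY.
  over.
have fEY : 'E_P[Y]%E \is a fin_num by rewrite -EY; exact: integrable_fin_num IY'.
by rewrite /= -(fineK fEY) integralZr// EX.
Qed.
End density.

Section independence.
Context d (T : measurableType d) (R : realType) (P : probability T R).

Lemma sigma_family_preimage (I : Type) (Y : I -> T -> R) (i : I) (B : set R) :
  measurable B -> sigma_family Y (Y i @^-1` B).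
Proof.
move=> mB; apply: sub_sigma_algebra; exists i => //.
by exists B => //; rewrite setTI.
Qed.

Lemma mutually_independent_pair (I : finType) (G : I -> set_system T) (i j : I)
    (A B : set T) :
  mutually_independent P G -> i != j -> G i A -> G j B ->
  (P (A `&` B) = P A * P B)%E.
Proof.
move=> indG ij GA GB.
pose F k := if k == i then A else B.
have Fi : F i = A by rewrite /F eqxx.
have Fj : F j = B by rewrite /F eq_sym (negbTE ij).
have := indG [set i; j]%SET F.
have -> : \bigcap_(k in [set` [set i; j]%SET]) F k = A `&` B.
  rewrite -Fi -Fj; apply/seteqP; split => [w H|w [Hi Hj] k /=].
    by split; apply: H; rewrite /= !inE eqxx ?orbT.
  by rewrite !inE => /orP[] /eqP ->.
rewrite big_setU1/= ?inE// big_set1 Fi Fj; apply => k.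
by rewrite !inE => /orP[] /eqP ->; rewrite ?Fi ?Fj.
Qed.

Lemma integral_mul_independent (X Y : T -> R) :
  measurable_fun setT X -> measurable_fun setT Y ->
  P.-integrable setT (EFin \o X) -> P.-integrable setT (EFin \o Y) ->
  (forall A B, measurable A -> measurable B ->
    P (X @^-1` A `&` Y @^-1` B) = P (X @^-1` A) * P (Y @^-1` B))%E ->
  (\int[P]_w (X w)%:E = 0)%E -> (\int[P]_w (X w * Y w)%:E = 0)%E.
Proof.
move=> mX mY IX IY XY X0.
by have := expectationM_independent mX mY IX IY XY; rewrite unlock X0 mul0e.
Qed.

Lemma integrable_of_square (N : T -> R) (v : R) : measurable_fun setT N ->
  (\int[P]_w (N w ^+ 2)%:E <= v%:E)%E -> P.-integrable setT (EFin \o N).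
Proof.
move=> mN Nv.
have mN2 : measurable_fun setT (fun w => (1 + N w ^+ 2)).
  by apply: measurable_funD => //; exact: measurable_funX.
have I2 : P.-integrable setT (EFin \o (fun w => 1 + N w ^+ 2)).
  apply/integrableP; split; first exact/measurable_EFinP.
  under eq_integral do rewrite /= ger0_norm ?addr_ge0 ?sqr_ge0// EFinD.
  rewrite ge0_integralD//; last 2 first.
  - by move=> w _; rewrite lee_fin sqr_ge0.
  - by apply/measurable_EFinP; exact: measurable_funX.
  rewrite integral_cst//= mul1e; apply: lte_add_pinfty.
    by rewrite probability_setT ltry.
  by apply: le_lt_trans Nv _; rewrite ltry.
apply: (le_integrable _ _ _ I2) => //; first exact/measurable_EFinP.
move=> w _; rewrite lee_fin [leRHS]ger0_norm ?addr_ge0 ?sqr_ge0//.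
have := sqr_ge0 (`|N w| - 1); rewrite sqrrB real_normK ?num_real// expr1n mulr1.
by have := normr_ge0 (N w); lra.
Qed.

Lemma integral_sum_sqr n (N : 'I_n -> T -> R) (v : R) :
  (forall i, measurable_fun setT (N i)) ->
  (forall i, \int[P]_w (N i w ^+ 2)%:E <= v%:E)%E ->
  (forall i j, i != j -> \int[P]_w (N i w * N j w)%:E = 0)%E ->
  (\int[P]_w ((\sum_(i < n) N i w) ^+ 2)%:E <= (n%:R * v)%:E)%E.
Proof.
move=> mN Nv N0.
have Isq i : P.-integrable setT (EFin \o (fun w => N i w ^+ 2)).
  apply/integrableP; split; first by apply/measurable_EFinP; exact: measurable_funX.
  under eq_integral do rewrite /= ger0_norm ?sqr_ge0//.
  by apply: le_lt_trans (Nv i) _; rewrite ltry.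
(* Needed to exchange sums and integral; it follows from |xy| <= x^2 + y^2. *)
have INN i j : P.-integrable setT (EFin \o (fun w => N i w * N j w)).
  apply: (le_integrable _ _ _ (integrableD measurableT (Isq i) (Isq j))) => //.
    by apply/measurable_EFinP; exact: measurable_funM.
  move=> w _; rewrite /= lee_fin [leRHS]ger0_norm ?addr_ge0 ?sqr_ge0//.
  rewrite ler_norml.
  have := sqr_ge0 (N i w - N j w); have := sqr_ge0 (N i w + N j w).
  by rewrite sqrrB sqrrD; move: (N i w) (N j w) => x y; move=> *; apply/andP; split; nra.
under eq_integral.
  move=> w _; rewrite expr2 big_distrlr/= -sumEFin.
  under eq_bigr do rewrite -sumEFin.
  over.
rewrite integral_sum//; last first.
  move=> i; have := @integrable_sum _ _ _ P setT measurableT _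
    (index_enum 'I_n) xpredT (fun j w => (N i w * N j w)%:E) (fun j _ => INN i j).
  exact.
rewrite (eq_bigr (fun i => \sum_(j < n) \int[P]_w (N i w * N j w)%:E)%E); last first.
  by move=> i _; rewrite integral_sum// => j; exact: INN.
have -> : (n%:R * v)%:E = (\sum_(i < n) v%:E)%E.
  by rewrite sumEFin sumr_const card_ord mulr_natl.
apply: lee_sum => i _; rewrite (bigD1 i)//= big1 ?adde0; last first.
  by move=> j ji; rewrite N0// eq_sym.
by under eq_integral do rewrite -expr2; exact: Nv.
Qed.

End independence.

(** * Moments of the Laplace law *)

Section laplace.
Context {R : realType}.
Notation mu := (@lebesgue_measure R).

(** The reflection x -> -x preserves Lebesgue measure and exchanges the positive and negative parts
    of [f]; integrability makes their difference meaningful. *)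
Lemma integral_odd (f : R -> R) : measurable_fun setT f ->
  (forall x, f (- x) = - f x) -> mu.-integrable setT (EFin \o f) ->
  (\int[mu]_x (f x)%:E = 0)%E.
Proof.
move=> mf oddf If.
rewrite integralE.
have -> : (\int[mu]_x (fun x => (f x)%:E)^\- x = \int[mu]_x (fun x => (f x)%:E)^\+ x)%E.
  have mp : measurable_fun setT (fun x : R => (f x)%:E)^\+%E.
    by apply: measurable_funepos; exact/measurable_EFinP.
  have H : (\int[mu]_x (fun x => (f x)%:E)^\+ x =
      \int[mu]_(x in (-%R : R -> measurableTypeR R) @^-1` setT)
        (fun x => (f x)%:E)^\+ (- x)%R)%E.
    rewrite -ge0_integral_pushforward//=.
    by apply: eq_measure_integral => //= A mA AS; exact/esym/lebesgue_measureN.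
  rewrite H preimage_setT; apply: eq_integral => x _.
  by rewrite funeposE funenegE oddf EFinN.
rewrite subee//; have := integrable_funepos measurableT If.
exact: integrable_fin_num.
Qed.

(** The constant comes from squaring x / 4 <= exp(x / 4). *)
Let sqr_le_expR (x : R) : 0 <= x -> x ^+ 2 <= 16 * expR (x / 2).
Proof.
move=> x0; have -> : x / 2 = x / 4 + x / 4 by field.
rewrite expRD -expr2; have := expR_ge1Dx (x / 4).
move: (expR (x / 4)) => e e1; nra.
Qed.

(** Half of the Laplace exponent; the other half absorbs the factor x^2. *)
Let expabs (x : R) := expR (- (2^-1 * `|x|)).

Let continuous_expabs : continuous expabs.
Proof.
move=> x; apply: (@continuous_comp _ _ _ (fun x : R => `|x|) (fun x => expR (- (2^-1 * x)))).
  exact: norm_continuous.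
exact: continuous_expRN.
Qed.

Let integral_expabs : (\int[mu]_x (expabs x)%:E = 4%:E)%E.
Proof.
rewrite ge0_symfun_integralT//.
- rewrite -set_itvcy.
  under eq_integral.
    move=> x; rewrite inE/= in_itv/= andbT => x0.
    rewrite /expabs ger0_norm//; over.
  rewrite integral_expRN ?invr_gt0// invrK -EFinM; congr EFin.
  by rewrite -natrM.
- by move=> x; exact: expR_ge0.
- by move=> x; rewrite /expabs/= normrN.
Qed.

Let laplace_sqr (x : R) : x ^+ 2 * laplace_pdf x <= 8 * expabs x.
Proof.
rewrite /laplace_pdf -real_normK ?num_real//.
have := sqr_le_expR (normr_ge0 x); have -> : - `|x| = - (2^-1 * `|x|) - `|x| / 2.
  by field.
rewrite expRD /expabs (expRN (`|x| / 2)).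
have := expR_gt0 (`|x| / 2); have := expR_gt0 (- (2^-1 * `|x|)).
move: (expR (`|x| / 2)) (expR _) => y e e0 y0 H.
rewrite (_ : `|x| ^+ 2 * (e * y^-1 / 2) = (`|x| ^+ 2 / y) * (e / 2)); last by ring.
have H2 : `|x| ^+ 2 / y <= 16 by rewrite ler_pdivrMr.
by nra.
Qed.

Let mlaplace : measurable_fun setT (@laplace_pdf R).
Proof.
apply: continuous_measurable_fun => x; apply: cvgM; last exact: cvg_cst.
apply: (@continuous_comp _ _ _ (fun x : R => - `|x|) expR); last exact: continuous_expR.
by apply: cvgN; exact: norm_continuous.
Qed.

Let laplace_ge0 (x : R) : 0 <= laplace_pdf x.
Proof. by rewrite divr_ge0 ?expR_ge0. Qed.

Section laplace_variable.
Context d (T : measurableType d) (P : probability T R) (X : {RV P >-> R}).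
Hypothesis Xlap : forall B, measurable B ->
  distribution P X B = (\int[mu]_(x in B) (laplace_pdf x)%:E)%E.

(** The bound is 8 * 4, from [laplace_sqr] and [integral_expabs]. The exact moment is 2, but any
    absolute constant serves. *)
Lemma laplace_second_moment : (\int[P]_w (X w ^+ 2)%:E <= 32%:E)%E.
Proof.
have msq : measurable_fun setT (fun x : R => x ^+ 2) by exact: measurable_funX.
have me : measurable_fun setT expabs by exact: continuous_measurable_fun.
rewrite (ge0_integral_density mlaplace Xlap msq); last first.
  by move=> x; exact: sqr_ge0.
apply: (@le_trans _ _ (\int[mu]_x (8%:E * (expabs x)%:E))%E).
  apply: ge0_le_integral => //.
  - by move=> x _; rewrite lee_fin mulr_ge0 ?sqr_ge0.
  - by apply/measurable_EFinP; exact: measurable_funM.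
  - by apply: emeasurable_funM => //; exact/measurable_EFinP.
  - by move=> x _; rewrite -EFinM lee_fin.
rewrite ge0_integralZl//.
- by rewrite integral_expabs -EFinM lee_fin -natrM.
- exact/measurable_EFinP.
- by move=> x _; rewrite lee_fin expR_ge0.
Qed.

Lemma laplace_mean : (\int[P]_w (X w)%:E = 0)%E.
Proof.
have mid : measurable_fun setT (fun x : R => x) by exact: measurable_id.
rewrite (integral_density mlaplace Xlap laplace_ge0 mid).
apply: integral_odd.
- exact: measurable_funM.
- by move=> x; rewrite /laplace_pdf normrN mulNr.
apply/integrableP; split.
  by apply/measurable_EFinP; exact: measurable_funM.
(* Integrability of x against the density is read off from that of [X], which the second moment
   provides. *)
have IX : P.-integrable setT (EFin \o X).
  exact: integrable_of_square (measurable_funPT X) laplace_second_moment.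
have [_] := integrableP _ _ _ IX.
rewrite /= (ge0_integral_density mlaplace Xlap (phi := fun x => `|x|))//.
move=> H; under eq_integral do rewrite /= normrM (ger0_norm (laplace_ge0 _)).
exact: H.
Qed.
End laplace_variable.
End laplace.

(** * Risk *)

Section bias.
Context {R : realType}.
Notation mu := (@lebesgue_measure R).
Notation K := (@sinc_kernel R).

(** The factor left in [smoothed_density_bias] when l = h^(s - 1/2) is divided out. *)
Definition bias_constant (s L : R) : R :=
  pi^-1 * (pi * L ^+ 2 + pi `^ (1 - 2 * s) / (2 * (2 * s - 1))).

Lemma sobolev_integrable (s L : R) (f : R -> R) : sobolev_ellipsoid s L f ->
  mu.-integrable setT (EFin \o f).
Proof.
move=> [mf f0 f1 _]; apply/integrableP; split; first exact/measurable_EFinP.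
under eq_integral do rewrite /= ger0_norm//.
by rewrite f1 ltry.
Qed.

Lemma sobolev_bias (s L h t : R) (f : R -> R) : 1 / 2 < s -> 0 < h ->
  sobolev_ellipsoid s L f ->
  (\int[mu]_x (scaled_kernel K h (x - t) * f x) - continuous_version f t) ^+ 2
    <= bias_constant s L ^+ 2 * h `^ (2 * s - 1).
Proof.
move=> hs h0 Sf; have If := sobolev_integrable Sf; case: (Sf) => mf f0 f1 Ef.
rewrite (continuous_versionE If f0 f1 hs Ef).
(* With this weight [l] and h^(2s-1) / l coincide, so the energy part and the tail part are both
   multiples of h^(s - 1/2). *)
have l0 : 0 < h `^ (s - 1 / 2) by exact: powR_gt0.
have lsq : h `^ (2 * s - 1) = (h `^ (s - 1 / 2)) ^+ 2.
  by rewrite -powR_mulrn ?powR_ge0// -powRrM; congr (_ `^ _); field.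
have := smoothed_density_bias If f0 f1 hs Ef t h0 l0.
have hV : h^-1 `^ (1 - 2 * s) = (h `^ (s - 1 / 2)) ^+ 2.
  by rewrite -lsq -powR_inv1 ?(ltW h0)// -powRrM mulN1r opprB.
rewrite powRM ?pi_ge0 ?invr_ge0 ?(ltW h0)// hV lsq.
set l := h `^ (s - 1 / 2) in l0 *; set q := pi `^ _; set b := _ - _.
have -> : pi^-1 * (l * (pi * L ^+ 2) + l^-1 * (q * l ^+ 2 / (2 * (2 * s - 1)))) =
    bias_constant s L * l.
  rewrite /bias_constant -/q; have := lt0r_neq0 (pi_gt0 R); move: pi => p p0.
  have s1 : 2 * s - 1 != 0 by apply/eqP; move: hs; lra.
  by field; rewrite p0 s1 gt_eqF.
move=> H; rewrite -exprMn -[leLHS]real_normK ?num_real// lerXn2r ?nnegrE//.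
exact: le_trans H.
Qed.

End bias.

Section risk.
Context {R : realType}.
Notation mu := (@lebesgue_measure R).
Notation K := (@sinc_kernel R).

Section sample.
Context d (T : measurableType d) (P : probability T R) (n : nat).
Variables (f : R -> R) (X : 'I_n -> {RV P >-> R}).
Hypothesis Xf : iid_with_density X f.
Hypothesis mf : measurable_fun setT f.
Hypothesis f_ge0 : forall x, 0 <= f x.

Lemma iid_pair (phi psi : R -> R) (i j : 'I_n) (A B : set R) :
  measurable_fun setT phi -> measurable_fun setT psi ->
  i != j -> measurable A -> measurable B ->
  (P ((phi \o X i) @^-1` A `&` (psi \o X j) @^-1` B) =
   P ((phi \o X i) @^-1` A) * P ((psi \o X j) @^-1` B))%E.
Proof.
move=> mphi mpsi ij mA mB; case: Xf => _ indX.
apply: (mutually_independent_pair indX ij).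
- rewrite comp_preimage.
  apply: (@sigma_family_preimage _ _ _ unit (fun=> X i) tt).
  by rewrite -[X in measurable X]setTI; exact: mphi.
- rewrite comp_preimage.
  apply: (@sigma_family_preimage _ _ _ unit (fun=> X j) tt).
  by rewrite -[X in measurable X]setTI; exact: mpsi.
Qed.

(* The variance is bounded by the squared sup norm only: for [K_h] this costs
   [1 / (n h^2)], a term that the privacy noise contributes anyway. *)
Lemma integral_sum_bounded_sqr (phi : R -> R) (a b : R) :
  measurable_fun setT phi -> (forall x, `|phi x| <= a) ->
  b = \int[mu]_x (phi x * f x) ->
  (\int[P]_w ((\sum_(i < n) (phi (X i w) - b)) ^+ 2)%:E
   <= (n%:R * (4 * a ^+ 2))%:E)%E.
Proof.
move=> mphi phia bE; case: (Xf) => dX _.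
have mX i : measurable_fun setT (phi \o X i).
  exact: (measurableT_comp mphi (measurable_funPT (X i))).
have IX i : P.-integrable setT (EFin \o (phi \o X i)).
  apply: (le_integrable measurableT _ _ (finite_measure_integrable_cst P a measurableT)).
    by apply/measurable_EFinP; exact: mX.
  by move=> w _; rewrite lee_fin (le_trans (phia _))// ler_norm.
have EX i : (\int[P]_w (phi (X i w))%:E = b%:E)%E.
  rewrite bE /Rintegral -(integral_density mf (dX i) f_ge0 mphi) fineK//.
  exact: integrable_fin_num (IX i).
have mY i : measurable_fun setT (fun w => phi (X i w) - b).
  by apply: measurable_funB => //; exact: mX.
have IY i : P.-integrable setT (EFin \o (fun w => phi (X i w) - b)).
  have := integrableB measurableT (IX i) (finite_measure_integrable_cst P b measurableT).
  exact.
have EY i : (\int[P]_w (phi (X i w) - b)%:E = 0)%E.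
  under eq_integral do rewrite EFinB.
  rewrite integralB_EFin//; last exact: finite_measure_integrable_cst.
    by rewrite EX integral_cst//= probability_setT mule1 subee.
  exact: IX.
apply: integral_sum_sqr => //.
- move=> i.
  have ba : `|b| <= a.
    have a0 : 0 <= a by exact: le_trans (phia 0).
    rewrite -lee_fin -[X in (X <= _)%E]/(`|b%:E|)%E -(EX i).
    apply: (le_trans (le_abse_integral _ _ _)) => //.
      exact: measurable_int (IX i).
    rewrite -[leRHS]mule1 -(probability_setT P) -integral_cst//.
    apply: ge0_le_integral => //.
    - by apply: measurableT_comp => //; exact: measurable_int (IX i).
    - by move=> w _; rewrite lee_fin phia.
  (* Both phi and its mean [b] are bounded by [a], so the centred variable is bounded by 2a. *)
  have Yb w : (phi (X i w) - b) ^+ 2 <= 4 * a ^+ 2.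
    have -> : 4 * a ^+ 2 = (2 * a) ^+ 2 by ring.
    rewrite -[leLHS]real_normK ?num_real//.
    rewrite lerXn2r ?nnegrE ?mulr_ge0 ?(le_trans _ ba)//.
    by rewrite (le_trans (ler_normB _ _))// mulr_natl mulr2n lerD.
  rewrite -[leRHS]mule1 -(probability_setT P) -integral_cst//.
  apply: ge0_le_integral => //.
  - by move=> w _; rewrite lee_fin sqr_ge0.
  - by apply/measurable_EFinP; exact: measurable_funX.
  - by move=> w _; rewrite lee_fin Yb.
- move=> i j ij; apply: integral_mul_independent => //.
  move=> A B mA mB.
  have ms : measurable_fun setT (fun x => phi x - b) by exact: measurable_funB.
  exact: (iid_pair ms ms ij mA mB).
Qed.
End sample.
End risk.

(** * Risk decomposition and privacy noise *)

Section mechanisms.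
Context {R : realType}.
Notation mu := (@lebesgue_measure R).
Notation K := (@sinc_kernel R).

(** The noise is kept abstract, as orthogonal variables [N i] with second moment at most [v] and
    scale [c], so that one estimate covers both mechanisms. *)
Lemma risk_le (s L h t c v : R) (f : R -> R) (n : nat)
    d (T : measurableType d) (P : probability T R)
    (X : 'I_n -> {RV P >-> R}) (N : 'I_n -> T -> R) (Z : 'I_n -> R -> T -> R) :
  1 / 2 < s -> (0 < n)%N -> 0 < h -> sobolev_ellipsoid s L f ->
  iid_with_density X f ->
  (forall i, measurable_fun setT (N i)) ->
  (forall i, \int[P]_w (N i w ^+ 2)%:E <= v%:E)%E ->
  (forall i j, i != j -> \int[P]_w (N i w * N j w)%:E = 0)%E ->
  (forall i w, Z i t w = scaled_kernel K h (X i w - t) + c * N i w) ->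
  ('E_P[fun w => ((estimator Z t w - continuous_version f t) ^+ 2)%R] <=
   (3 * (4 * h^-1 ^+ 2 / n%:R + bias_constant s L ^+ 2 * h `^ (2 * s - 1)
         + c ^+ 2 * v / n%:R))%:E)%E.
Proof.
move=> hs n0 h0 Sf Xf mN Nv N0 ZE; case: (Sf) => mf f_ge0 _ _.
have nR0 : 0 < n%:R :> R by rewrite ltr0n.
pose phi x := scaled_kernel K h (x - t).
pose b := \int[mu]_x (phi x * f x).
pose g := continuous_version f t.
have mphi : measurable_fun setT phi.
  by apply: continuous_measurable_fun; exact: continuous_scaled_sinc.
have phih x : `|phi x| <= h^-1 by exact: scaled_sinc_le.
pose S1 w := \sum_(i < n) (phi (X i w) - b).
pose S2 w := \sum_(i < n) N i w.
have S1E : (\int[P]_w (S1 w ^+ 2)%:E <= (n%:R * (4 * h^-1 ^+ 2))%:E)%E.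
  exact: (integral_sum_bounded_sqr Xf mf f_ge0 mphi phih erefl).
have S2E : (\int[P]_w (S2 w ^+ 2)%:E <= (n%:R * v)%:E)%E by exact: integral_sum_sqr.
have mS1 : measurable_fun setT S1.
  apply: measurable_sum => i; apply: measurable_funB => //.
  exact: (measurableT_comp mphi (measurable_funPT (X i))).
have mS2 : measurable_fun setT S2 by exact: measurable_sum.
have mS1q : measurable_fun setT (fun w => (S1 w ^+ 2)%:E).
  by apply/measurable_EFinP; exact: measurable_funX.
have mS2q : measurable_fun setT (fun w => (S2 w ^+ 2)%:E).
  by apply/measurable_EFinP; exact: measurable_funX.
(* The three summands are the sampling fluctuation, the bias and the privacy noise. *)
have estE w : estimator Z t w - g = n%:R^-1 * S1 w + (b - g) + c / n%:R * S2 w.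
  have -> : estimator Z t w = n%:R^-1 * (S1 w + n%:R * b + c * S2 w).
    rewrite /estimator; congr (_ * _); rewrite /S1 /S2 mulr_sumr sumrB.
    rewrite sumr_const card_ord -[b *+ _]mulr_natl subrK -big_split/=.
    by apply: eq_bigr => i _; rewrite ZE.
  by field; rewrite gt_eqF.
rewrite unlock.
(* The factor 3 of [cube] times the squared weights 1/n and c/n of [estE]. *)
pose u : R := 3 / n%:R ^+ 2; pose y : R := 3 * (c ^+ 2 / n%:R ^+ 2).
have u0 : 0 <= u by rewrite divr_ge0// sqr_ge0.
have y0 : 0 <= y by rewrite mulr_ge0// divr_ge0// sqr_ge0.
apply: (@le_trans _ _ (\int[P]_w (u%:E * (S1 w ^+ 2)%:E +
    ((3 * (b - g) ^+ 2)%:E + y%:E * (S2 w ^+ 2)%:E)))%E).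
  apply: ge0_le_integral => //.
  - by move=> w _; rewrite lee_fin sqr_ge0.
  - apply/measurable_EFinP; apply: measurable_funX.
    rewrite (_ : (fun w => _) = fun w => n%:R^-1 * S1 w + (b - g) + c / n%:R * S2 w); last first.
      by apply/funext => w; rewrite estE.
    apply: measurable_funD; last exact: measurable_funM.
    by apply: measurable_funD => //; exact: measurable_funM.
  - apply: emeasurable_funD; first exact: emeasurable_funM.
    by apply: emeasurable_funD => //; exact: emeasurable_funM.
  - move=> w _; rewrite estE -!EFinM -!EFinD lee_fin /u /y.
    have cube (p q r : R) : (p + q + r) ^+ 2 <= 3 * p ^+ 2 + (3 * q ^+ 2 + 3 * r ^+ 2).
      have := sqr_ge0 (p - q); have := sqr_ge0 (p - r); have := sqr_ge0 (q - r).
      by nra.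
    apply: le_trans (cube _ _ _) _; rewrite le_eqVlt; apply/orP; left; apply/eqP.
    by field; rewrite gt_eqF.
rewrite ge0_integralD//; last 4 first.
- by move=> w _; rewrite -EFinM lee_fin mulr_ge0// sqr_ge0.
- exact: emeasurable_funM.
- by move=> w _; rewrite -EFinM -EFinD lee_fin addr_ge0// mulr_ge0// sqr_ge0.
- by apply: emeasurable_funD => //; exact: emeasurable_funM.
rewrite ge0_integralD//; last 3 first.
- by move=> w _; rewrite lee_fin mulr_ge0// sqr_ge0.
- by move=> w _; rewrite -EFinM lee_fin mulr_ge0// sqr_ge0.
- exact: emeasurable_funM.
rewrite integral_cst//= probability_setT mule1.
rewrite !ge0_integralZl//; last 2 first.
- by move=> w _; rewrite lee_fin sqr_ge0.
- by move=> w _; rewrite lee_fin sqr_ge0.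
have := sobolev_bias t hs h0 Sf; rewrite -/b -/g => bias.
apply: (@le_trans _ _ (u%:E * (n%:R * (4 * h^-1 ^+ 2))%:E +
  ((3 * (bias_constant s L ^+ 2 * h `^ (2 * s - 1)))%:E + y%:E * (n%:R * v)%:E))%E).
  apply: leeD; first by rewrite lee_wpmul2l.
  apply: leeD; first by rewrite lee_fin ler_wpM2l.
  by rewrite lee_wpmul2l.
rewrite -!EFinM -!EFinD lee_fin /u /y le_eqVlt; apply/orP; left; apply/eqP.
by field; rewrite !gt_eqF.
Qed.

(* The scale [c] of the noise depends on [h], but [c ^+ 2 * h ^+ 2] does not. *)
Lemma mechanism_noise (M : mechanism R) : exists2 V : R, 0 <= V &
  forall (f : R -> R) (n : nat) (h : R) d (T : measurableType d)
    (P : probability T R) (Z : 'I_n -> R -> T -> R) (t : R),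
  0 < h -> privatized_sample K M f h P Z ->
  exists (X : 'I_n -> {RV P >-> R}) (N : 'I_n -> T -> R) (c v : R),
    [/\ iid_with_density X f,
        (forall i, measurable_fun setT (N i)),
        (forall i, \int[P]_w (N i w ^+ 2)%:E <= v%:E)%E,
        (forall i j, i != j -> \int[P]_w (N i w * N j w)%:E = 0)%E &
        (forall i w, Z i t w = scaled_kernel K h (X i w - t) + c * N i w)
        /\ c ^+ 2 * v = V * h^-1 ^+ 2].
Proof.
case: M => [alpha beta|alpha beta Delta].
(* The scale is inversely proportional to [h] (and 0 when beta is 1), so its value at [h = 1] gives
   the constant; 32 bounds the Laplace second moment. *)
- exists ((laplace_scale K alpha beta 1) ^+ 2 * 32).
    by rewrite mulr_ge0// sqr_ge0.
  move=> f n h d T P Z t h0 [X Xf [xi [[dxi indxi] _ ZE]]].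
  exists X, (fun i => xi i : T -> R), (laplace_scale K alpha beta h), 32; split => //.
  + by move=> i; exact: laplace_second_moment (dxi i).
  + move=> i j ij.
    have Ixi k : P.-integrable setT (EFin \o xi k).
      exact: integrable_of_square (measurable_funPT (xi k)) (laplace_second_moment (dxi k)).
    apply: integral_mul_independent => //; last exact: laplace_mean (dxi i).
    move=> A B mA mB; apply: (mutually_independent_pair indxi ij).
      exact: (@sigma_family_preimage _ _ _ unit (fun=> xi i) tt).
    exact: (@sigma_family_preimage _ _ _ unit (fun=> xi j) tt).
  + split=> //; rewrite /laplace_scale; case: ifPn => _.
      by rewrite expr0n/= !mul0r.
    by rewrite mul1r invfM mulrCA [in LHS]exprMn; ring.
- exists ((gaussian_scale alpha beta Delta 1) ^+ 2).
    exact: sqr_ge0.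
  move=> f n h d T P Z t h0 [X Xf [Xi [GXi indXi _ ZE]]].
  exists X, (fun i => Xi i t : T -> R), (gaussian_scale alpha beta Delta h), 1.
  (* The variance at [t] is the covariance kernel on the diagonal, that is K(0) = 1. *)
  have sq i : (\int[P]_w (Xi i t w ^+ 2)%:E = 1)%E.
    have [_ /(_ t) EXi /(_ t t)] := GXi i.
    rewrite unlock EXi/= unlock subrr mul0r /sinc_kernel eqxx => <-.
    by apply: eq_integral => w _; rewrite !fctE/= subr0 expr2.
  split => //.
  + by move=> i; rewrite sq.
  + move=> i j ij.
    have IXi k : P.-integrable setT (EFin \o Xi k t).
      by apply: (integrable_of_square (v := 1)) => //; rewrite sq.
    apply: integral_mul_independent => //; last first.
      by have [_ /(_ t) EXi _] := GXi i; rewrite -EXi unlock.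
    move=> A B mA mB; apply: (mutually_independent_pair indXi ij).
      exact: (@sigma_family_preimage _ _ _ R (fun u => Xi i u) t).
    exact: (@sigma_family_preimage _ _ _ R (fun u => Xi j u) t).
  + by split=> //; rewrite mulr1 /gaussian_scale [1 * alpha]mul1r [(h * alpha)^-1]invfM; ring.
Qed.
End mechanisms.

Lemma sup_risk_le (R : realType) (s L : R) (M : mechanism R) : 1 / 2 < s ->
  exists2 C : R, 0 < C &
     forall (t : R) (n : nat) (h : R), (0 < n)%N -> 0 < h ->
       (sup_risk (@sinc_kernel R) M s L n h t
        <= (C * (h `^ (2 * s - 1) + 1 / (n%:R * h) + 1 / (n%:R * h ^+ 2)))%:E)%E.
Proof.
move=> hs; have [V V0 HV] := mechanism_noise M.
(* Sampling (4) and noise ([V]) count against 1/(n h^2), the squared bias against h^(2s-1); the sum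
   of the coefficients dominates each of them, and the 4 makes it positive. *)
exists (3 * (4 + bias_constant s L ^+ 2 + V)).
  by rewrite mulr_gt0// -addrA ltr_pwDl// addr_ge0// sqr_ge0.
move=> t n h n0 h0; have nR0 : 0 < n%:R :> R by rewrite ltr0n.
apply: ge_ereal_sup => _ [f [Sf [d [T [P [Z [MZ ->]]]]]]].
have [X [N [c [v [Xf mN Nv N0 [ZE cv]]]]]] := HV f n h d T P Z t h0 MZ.
apply: le_trans (risk_le hs n0 h0 Sf Xf mN Nv N0 ZE) _.
rewrite lee_fin cv -[leRHS]mulrA ler_wpM2l//.
have B0 := sqr_ge0 (bias_constant s L); have p0 := powR_ge0 h (2 * s - 1).
have q0 : 0 <= 1 / (n%:R * h) by rewrite divr_ge0// mulr_ge0// ltW.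
have -> : 4 * h^-1 ^+ 2 / n%:R = 4 * (1 / (n%:R * h ^+ 2)).
  by field; rewrite !gt_eqF.
have -> : V * h^-1 ^+ 2 / n%:R = V * (1 / (n%:R * h ^+ 2)).
  by field; rewrite !gt_eqF.
have r0 : 0 <= 1 / (n%:R * h ^+ 2) by rewrite divr_ge0// mulr_ge0// sqr_ge0.
move: (bias_constant _ _ ^+ 2) (h `^ _) (1 / (n%:R * h)) (1 / (n%:R * h ^+ 2)) B0 p0 q0 r0.
by move=> B p q r B0 p0 q0 r0; nra.
Qed.

(** * Optimal bandwidth *)

Section optimal_rate.
Context {R : realType}.
Variables (s : R) (h : nat -> R).
Hypothesis hs : 1 / 2 < s.
Hypothesis h_gt0 : forall n, (0 < n)%N -> 0 < h n.
Let rate (n : nat) : R := n%:R `^ (- ((2 * s - 1) / (2 * s + 1))).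
Let bound (n : nat) : R :=
  (h n) `^ (2 * s - 1) + 1 / (n%:R * h n) + 1 / (n%:R * h n ^+ 2).

Lemma bound_eventually :
  h =Theta_\oo (fun n : nat => n%:R `^ (- (1 / (2 * s + 1))) : R) ->
  exists2 A : R, 0 < A & \forall n \near \oo, bound n <= A * rate n.
Proof.
rewrite eqThetaE => /asboolP[[k1 k2] /= /andP[k10 k20] H].
(* One constant per term of [bound]: the upper Theta constant for the positive power of [h], the
   lower one for the two inverse powers. *)
exists (k2 `^ (2 * s - 1) + k1^-1 + k1^-1 ^+ 2).
  by rewrite -addrA ltr_pwDl ?powR_gt0// addr_ge0 ?sqr_ge0// invr_ge0 ltW.
near=> n; have n0 : (0 < n)%N by near: n; exists 1%N.
have nR : 1 <= n%:R :> R by rewrite ler1n.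
have nR0 : 0 < n%:R :> R by exact: lt_le_trans nR.
have hn := h_gt0 n0.
have : k1 * `|n%:R `^ (- (1 / (2 * s + 1)))| <= `|h n| /\
       `|h n| <= k2 * `|n%:R `^ (- (1 / (2 * s + 1)))| by near: n; exact: H.
rewrite (gtr0_norm hn) (ger0_norm (powR_ge0 _ _)).
set q := _ `^ _ => -[h1 h2].
have q0 : 0 < q by exact: powR_gt0.
have s1 : 0 < 2 * s + 1 by move: hs; lra.
have s2 : 0 < 2 * s - 1 by move: hs; lra.
have E1 : q `^ (2 * s - 1) = rate n.
  by rewrite /q -powRrM; congr (_ `^ _); field; rewrite gt_eqF.
(* Together with [E1] this is the balance: -1 + 2/(2s+1) = -(2s-1)/(2s+1). *)
have E2 : n%:R^-1 * q^-1 ^+ 2 = rate n.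
  rewrite -powR_inv1 ?ltW// -[q^-1 ^+ 2]powR_mulrn ?invr_ge0 ?(ltW q0)//.
  rewrite /q -powRN -!powRrM -powRD.
    by congr (_ `^ _); field; rewrite gt_eqF.
  by rewrite (gt_eqF nR0) implybT.
(* Hence 1/(n q) is at most 1/(n q^2), and the term in 1/(n h) is of no larger order than the
   rate. *)
have q1 : 1 <= q^-1.
  by rewrite /q powRN invrK -[leLHS](powRr0 (n%:R : R)) ler_powR// divr_ge0// ltW//.
have hV : (h n)^-1 <= k1^-1 * q^-1.
  by rewrite -invfM lef_pV2 ?posrE// mulr_gt0.
have hV0 : 0 <= (h n)^-1 by rewrite invr_ge0 ltW.
have n10 : 0 <= n%:R^-1 :> R by rewrite invr_ge0 ltW.
rewrite /bound [leRHS]mulrDl; apply: lerD; first (rewrite [leRHS]mulrDl; apply: lerD).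
- rewrite -E1 -powRM ?(ltW k20) ?(ltW q0)// ge0_ler_powR ?nnegrE ?(ltW hn) ?(ltW s2)//.
  by rewrite mulr_ge0// ltW.
- rewrite div1r invfM -E2 (mulrCA k1^-1) ler_wpM2l//.
  apply: le_trans hV _; rewrite ler_wpM2l ?invr_ge0 ?(ltW k10)// expr2.
  by rewrite ler_peMl// (le_trans ler01).
- rewrite div1r invfM -E2 (mulrCA (k1^-1 ^+ 2)) ler_wpM2l// -exprVn -exprMn.
  by rewrite lerXn2r ?nnegrE// (le_trans hV0).
Unshelve. all: by end_near. Qed.

Lemma bound_le_rate :
  h =Theta_\oo (fun n : nat => n%:R `^ (- (1 / (2 * s + 1))) : R) ->
  exists2 A : R, 0 < A & forall n, (0 < n)%N -> bound n <= A * rate n.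
Proof.
move=> /bound_eventually[A A0 [m _ Hm]].
have b0 k : (0 < k)%N -> 0 <= bound k / rate k.
  move=> k0; have hk := ltW (h_gt0 k0).
  by rewrite divr_ge0 ?powR_ge0// !addr_ge0 ?powR_ge0// divr_ge0// mulr_ge0// sqr_ge0.
(* [S] absorbs the finitely many [n] not covered by the Theta estimate. *)
pose S := \sum_(k < m | (0 < k)%N) (bound k / rate k).
have S0 : 0 <= S by apply: sumr_ge0 => k; exact: b0.
exists (A + S); first by rewrite ltr_wpDr.
move=> n n0; have r0 : 0 < rate n by rewrite powR_gt0 ?ltr0n.
rewrite mulrDl; have [mn|nm] := leqP m n.
  by rewrite (le_trans (Hm n mn))// lerDl mulr_ge0// ltW.
apply: (@le_trans _ _ (S * rate n)); last by rewrite lerDr mulr_ge0// ltW.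
rewrite -ler_pdivrMr// /S (bigD1 (Ordinal nm))//= lerDl.
by apply: sumr_ge0 => k /andP[k0 _]; exact: b0.
Qed.
End optimal_rate.

Theorem proposition3p1 (R : realType) (s L : R) (M : mechanism R)
    (hs : 1 / 2 < s) (hL : 0 < L) (hM : admissible (@sinc_kernel R) M) :
  (exists2 C : R, 0 < C &
     forall (t : R) (n : nat) (h : R), (0 < n)%N -> 0 < h ->
       (sup_risk (@sinc_kernel R) M s L n h t
        <= (C * (h `^ (2 * s - 1) + 1 / (n%:R * h) + 1 / (n%:R * h ^+ 2)))%:E)%E)
  /\
  (forall hstar : nat -> R, (forall n, (0 < n)%N -> 0 < hstar n) ->
     hstar =Theta_\oo (fun n : nat => n%:R `^ (- (1 / (2 * s + 1))) : R) ->
     exists2 C : R, 0 < C &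
       forall (t : R) (n : nat), (0 < n)%N ->
         (sup_risk (@sinc_kernel R) M s L n (hstar n) t
          <= (C * n%:R `^ (- ((2 * s - 1) / (2 * s + 1))))%:E)%E).
Proof.
have [C C0 HC] := sup_risk_le L M hs; split; first by exists C.
move=> h h0 /(bound_le_rate hs h0)[A A0 HA].
exists (C * A); first exact: mulr_gt0.
move=> t n n0; apply: le_trans (HC t n (h n) n0 (h0 n n0)) _.
by rewrite lee_fin -mulrA ler_pM2l// HA.
Qed.
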